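(* Let $n\ge 2$ be an integer. There is no algorithm which, given a timed automaton $\mathcal{A}$ with $n$ clocks, decides whether there exists a timed automaton $\mathcal{B}$ with $n-1$ clocks such that $L(\mathcal{B})=L(\mathcal{A})$.
   Context: $\mathcal{R}$ denotes the set of positive reals. A (finite) timed word over a finite alphabet $\Sigma$ is a sequence $t_1.a_1.t_2.a_2\ldots t_n.a_n$ with $t_i\in\mathcal{R}$ (time lapses between events) and $a_i\in\Sigma$; a timed language is a set of such words. A timed automaton (in the sense of Alur and Dill) has a finite set of real-valued clocks, a finite set of states with initial and final states, and finitely many transitions, each labelled by a letter of $\Sigma$ (no $\varepsilon$-transitions), carrying a diagonal-free clock guard (a Boolean combination of constraints $x\sim c$ with $x$ a clock, $c$ a nonnegative integer constant) and a set of clocks reset to zero. Clocks increase at rate 1 during time lapses; a timed word is accepted if some run on it ends in a final state. $L(\mathcal{A})$ is the timed language accepted by $\mathcal{A}$. *)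

(* Defs.v *)
From HB Require Import structures.
From mathcomp Require Import all_boot all_order all_algebra.
From mathcomp Require Import interval_inference classical_sets reals.

Set Implicit Arguments.
Unset Strict Implicit.
Unset Printing Implicit Defensive.

Import Order.TTheory GRing.Theory Num.Theory.

(* Clocks are 'I_n, states 'I_q, letters 'I_k. *)

Inductive comparison_op := OpLt | OpLe | OpEq | OpGe | OpGt.

Inductive guard (n : nat) :=
  | GTrue
  | GAtom of 'I_n & comparison_op & nat
  | GNot of guard n
  | GAnd of guard n & guard n
  | GOr of guard n & guard n.

Record transition (k q n : nat) := Transition {
  tr_source : 'I_q;
  tr_letter : 'I_k;
  tr_guard : guard n;
  tr_resets : {set 'I_n};
  tr_target : 'I_q }.

Record timed_automaton (k n : nat) := TimedAutomaton {
  nb_states : nat;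
  initial : {set 'I_nb_states};
  final : {set 'I_nb_states};
  transitions : seq (transition k nb_states n) }.

(* Goedel numbering. CodeSeq.code is MathComp's bijection seq nat -> nat, with
   code [::] = 0 and code (x :: s) = 2 ^ x * (2 * code s + 1). *)

Definition comparison_op_code (o : comparison_op) : nat :=
  match o with OpLt => 0 | OpLe => 1 | OpEq => 2 | OpGe => 3 | OpGt => 4 end.

Fixpoint guard_code n (g : guard n) : nat :=
  match g with
  | GTrue => CodeSeq.code [:: 0]
  | GAtom x o c => CodeSeq.code [:: 1; val x; comparison_op_code o; c]
  | GNot g1 => CodeSeq.code [:: 2; guard_code g1]
  | GAnd g1 g2 => CodeSeq.code [:: 3; guard_code g1; guard_code g2]
  | GOr g1 g2 => CodeSeq.code [:: 4; guard_code g1; guard_code g2]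
  end.

Definition set_code m (A : {set 'I_m}) : nat :=
  CodeSeq.code [seq val i | i <- enum A].

Definition transition_code k q n (e : transition k q n) : nat :=
  CodeSeq.code [:: val (tr_source e); val (tr_letter e);
    guard_code (tr_guard e); set_code (tr_resets e); val (tr_target e)].

(* The alphabet size is part of the input. *)
Definition automaton_code n (A : {k : nat & timed_automaton k n}) : nat :=
  let: existT k B := A in
  CodeSeq.code [:: k; nb_states B; set_code (initial B); set_code (final B);
    CodeSeq.code [seq transition_code e | e <- transitions B]].

Lemma CodeSeq_code_inj : injective CodeSeq.code.
Proof. exact: can_inj CodeSeq.codeK. Qed.

Lemma comparison_op_code_inj : injective comparison_op_code.
Proof. by case; case. Qed.

Lemma guard_code_inj n : injective (@guard_code n).
Proof.
elim=> [|x o c|g IHg|g1 IH1 g2 IH2|g1 IH1 g2 IH2]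
       [|x' o' c'|g'|g1' g2'|g1' g2'] /CodeSeq_code_inj //.
- by case=> /val_inj-> /comparison_op_code_inj-> ->.
- by case=> /IHg->.
- by case=> /IH1-> /IH2->.
- by case=> /IH1-> /IH2->.
Qed.

Lemma set_code_inj m : injective (@set_code m).
Proof.
move=> A B /CodeSeq_code_inj /(inj_map val_inj) eqAB.
by apply/setP=> i; rewrite -mem_enum eqAB mem_enum.
Qed.

Lemma transition_code_inj k q n : injective (@transition_code k q n).
Proof.
move=> [s a g r t] [s' a' g' r' t'] /CodeSeq_code_inj [] /=.
by move=> /val_inj-> /val_inj-> /guard_code_inj-> /set_code_inj-> /val_inj->.
Qed.

Lemma automaton_code_inj n : injective (@automaton_code n).
Proof.
move=> [k [q i f e]] [k' [q' i' f' e']] /CodeSeq_code_inj [] /=.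
move=> eqk eqq; case: k' / eqk e' => e'; case: q' / eqq i' f' e' => i' f' e'.
move=> /set_code_inj-> /set_code_inj-> /CodeSeq_code_inj.
by move=> /(inj_map (@transition_code_inj k q n))->.
Qed.

HB.instance Definition _ k q n :=
  Equality.copy (transition k q n) (inj_type (@transition_code_inj k q n)).

Section Semantics.
Local Open Scope ring_scope.
Variable R : realType.

Definition timed_word (k : nat) := seq ({posnum R} * 'I_k).

Definition valuation (n : nat) := 'I_n -> R.

Definition compare (o : comparison_op) (x y : R) : bool :=
  match o with
  | OpLt => x < y
  | OpLe => x <= y
  | OpEq => x == y
  | OpGe => y <= x
  | OpGt => y < x
  end.

Fixpoint sat n (nu : valuation n) (g : guard n) : bool :=
  match g with
  | GTrue => true
  | GAtom x o c => compare o (nu x) c%:R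
  | GNot g1 => ~~ sat nu g1
  | GAnd g1 g2 => sat nu g1 && sat nu g2
  | GOr g1 g2 => sat nu g1 || sat nu g2
  end.

Definition elapse n (nu : valuation n) (t : R) : valuation n :=
  fun x => nu x + t.

Definition reset n (nu : valuation n) (r : {set 'I_n}) : valuation n :=
  fun x => if x \in r then 0 else nu x.

Fixpoint accepts_from k n (A : timed_automaton k n) (s : 'I_(nb_states A))
    (nu : valuation n) (w : timed_word k) : Prop :=
  match w with
  | [::] => s \in final A
  | (t, a) :: w' =>
      exists2 e, e \in transitions A &
        [/\ tr_source e = s, tr_letter e = a,
            sat (elapse nu t%:num) (tr_guard e) &
            accepts_from (tr_target e)
              (reset (elapse nu t%:num) (tr_resets e)) w']
  end.

Definition language k n (A : timed_automaton k n) : set (timed_word k) :=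
  [set w | exists2 s, s \in initial A & accepts_from s (fun=> 0) w]%classic.

End Semantics.

Arguments language R {k n} A _.

(* Algorithms are partial recursive functions. Programs carry no arity; one
   applied to too few arguments has no value. *)

Inductive murec :=
  | MZero
  | MSucc
  | MProj of nat
  | MComp of murec & seq murec
  | MPrimRec of murec & murec
  | MMu of murec.

(* computes p xs y: the partial function of p is defined at xs with value y. *)
Inductive computes : murec -> seq nat -> nat -> Prop :=
  | computes_zero xs : computes MZero xs 0
  | computes_succ x xs : computes MSucc (x :: xs) x.+1
  | computes_proj i xs : i < size xs -> computes (MProj i) xs (nth 0 xs i)
  | computes_comp f gs xs ys z :
      computes_all gs xs ys -> computes f ys z -> computes (MComp f gs) xs z
  | computes_primrec0 f g xs y :
      computes f xs y -> computes (MPrimRec f g) (0 :: xs) y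
  | computes_primrecS f g m xs y z :
      computes (MPrimRec f g) (m :: xs) y -> computes g [:: m, y & xs] z ->
      computes (MPrimRec f g) (m.+1 :: xs) z
  | computes_mu f xs m (v : nat -> nat) :
      (forall i, i < m -> computes f (i :: xs) (v i).+1) ->
      computes f (m :: xs) 0 -> computes (MMu f) xs m
with computes_all : seq murec -> seq nat -> seq nat -> Prop :=
  | computes_nil xs : computes_all [::] xs [::]
  | computes_cons g gs xs y ys :
      computes g xs y -> computes_all gs xs ys ->
      computes_all (g :: gs) xs (y :: ys).

Definition algorithmically_decidable T (code : T -> nat) (P : T -> Prop) :=
  exists f : murec, forall x : T,
    (P x -> computes f [:: code x] 1) /\ (~ P x -> computes f [:: code x] 0).

(* Main.v *)
Require Import Defs.
From HB Require Import structures.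
From mathcomp Require Import all_boot all_order all_algebra.
From mathcomp Require Import interval_inference classical_sets reals.
From mathcomp Require Import boolp zify lra.

(**
A murec program is compiled to a counter program and then to a machine with a
queue, each rule of which may pop and push a symbol. Runs of the machine are
coded by timed words whose letters are the rules, in such a way that a symbol
pushed at date t is popped at date t + 1. Since time is dense such dates can
always be found, and two clocks suffice to recognize the words that do not code
a halting run, by guessing where they go wrong. The input u of the machine is
dictated by the constant of a single guard: in the initial phase a marker goes
round the queue, once per time unit, adding a token each time, and the end of
this phase must come exactly u time units after the first event.

Let the automaton A accept the words v c^j such that either v does not code a
halting run, or the c's occur at 2n dates T_1 < ... < T_2n with
T_(n+i) = T_i + 1. If no halting run exists, L(A) needs no clock at all.
Otherwise fix v coding one: for generic dates an automaton with n - 1 clocks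
forgets some T_i after n letters c, and accepts as well after a small change of
T_(n+i).

Finally let the input u be the code of the list of all transitions of A but the
one containing the constant u, with u also serving as the number of states and
letters; then the code of A is a simple function h(u). Running the alleged
decision procedure on h(u), then halting if it says that A is equivalent to an
automaton with n - 1 clocks and looping otherwise, is contradictory.
*)

Set Implicit Arguments.
Unset Strict Implicit.
Unset Printing Implicit Defensive.

Import Order.TTheory GRing.Theory Num.Theory.

(** * Compiling recursive functions to loop programs *)

Definition store := nat -> nat.

Definition upd (s : store) r v : store := fun x => if x == r then v else s x.

(* [Loop r c] is [while r > 0 do r := r - 1; c]. *)
Inductive com := Skip | Inc of nat | Seq of com & com | Loop of nat & com.

Inductive exec : com -> store -> store -> Prop :=
  | exec_skip s : exec Skip s s
  | exec_inc r s : exec (Inc r) s (upd s r (s r).+1)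
  | exec_seq c1 c2 s1 s2 s3 :
      exec c1 s1 s2 -> exec c2 s2 s3 -> exec (Seq c1 c2) s1 s3
  | exec_loop0 r c s : s r = 0 -> exec (Loop r c) s s
  | exec_loopS r c s1 s2 s3 m :
      s1 r = m.+1 -> exec c (upd s1 r m) s2 -> exec (Loop r c) s2 s3 ->
      exec (Loop r c) s1 s3.

Lemma exec_eq c s1 s2 s3 : exec c s1 s2 -> s2 =1 s3 -> exec c s1 s3.
Proof. by move=> e /funext <-. Qed.

Definition clear r := Loop r Skip.
Definition move_reg a b := Loop a (Inc b).
Definition copy_reg a b t := Seq (Loop a (Seq (Inc t) (Inc b))) (move_reg t a).

Ltac upd_cases := rewrite /upd /=; repeat match goal with
  | |- context [@eq_op _ ?a ?b] => case: (a =P b) => ? end; subst;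
  try first [by [] | lia | by exfalso; lia].

Lemma exec_clear r s : exec (clear r) s (upd s r 0).
Proof.
move E: (s r) => m; elim: m s E => [|m IH] s E.
  by apply: exec_eq (exec_loop0 _ E) _ => x; upd_cases.
apply: exec_loopS E (exec_skip _) _.
by apply: exec_eq (IH _ _) _ => [|x]; upd_cases.
Qed.

Lemma exec_move a b s : a <> b ->
  exec (move_reg a b) s (upd (upd s b (s b + s a)) a 0).
Proof.
move=> ab; move E: (s a) => m; elim: m s E => [|m IH] s E.
  by apply: exec_eq (exec_loop0 _ E) _ => x; upd_cases.
apply: exec_loopS E (exec_inc _ _) _.
by apply: exec_eq (IH _ _) _ => [|x]; upd_cases.
Qed.

Lemma exec_copy a b t s : a <> b -> a <> t -> b <> t -> s t = 0 ->
  exec (copy_reg a b t) s (upd s b (s b + s a)).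
Proof.
move=> ab at_ bt st0.
have H : exec (Loop a (Seq (Inc t) (Inc b))) s
    (upd (upd (upd s b (s b + s a)) t (s t + s a)) a 0).
  (* The hypothesis on [t] is dropped before the induction, since it fails after one iteration. *)
  move: st0 => _; move E: (s a) => m; elim: m s E => [|m IH] s E.
    by apply: exec_eq (exec_loop0 _ E) _ => x; upd_cases.
  apply: exec_loopS E (exec_seq (exec_inc _ _) (exec_inc _ _)) _.
  by apply: exec_eq (IH _ _) _ => [|x]; upd_cases.
apply: exec_seq H _; apply: exec_eq (exec_move _ _) _; first by move=> /esym.
by move=> x; upd_cases.
Qed.

Fixpoint clear_range b m :=
  if m is m'.+1 then Seq (clear b) (clear_range b.+1 m') else Skip.

Lemma exec_clear_range b m s :
  exec (clear_range b m) s (fun x => if b <= x < b + m then 0 else s x).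
Proof.
elim: m b s => [|m IH] b s /=.
  by apply: exec_eq (exec_skip _) _ => x; case: ifP => //; lia.
apply: exec_seq (exec_clear _ _) _; apply: exec_eq (IH _ _) _ => x.
by rewrite /upd; do ![case: ifP] => //; lia.
Qed.

(* [compile f args out fr] adds to register [out] the value of [f] at the
   contents of the registers [args]; the registers from [fr] on are scratch
   space, zero before and after. *)
Fixpoint compile (f : murec) (args : seq nat) (out fr : nat) : com :=
  match f with
  | MZero => Skip
  | MSucc => Seq (copy_reg (head 0 args) out fr) (Inc out)
  | MProj i => copy_reg (nth 0 args i) out fr
  | MComp f gs =>
      let fr' := fr + size gs in
      let fix compile_all gs b :=
        if gs is g :: gs' then Seq (compile g args b fr') (compile_all gs' b.+1)
        else Skip in
      Seq (compile_all gs fr)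
        (Seq (compile f (iota fr (size gs)) out fr') (clear_range fr (size gs)))
  | MPrimRec f g =>
      let cnt := fr in let idx := fr.+1 in let acc := fr.+2 in
      let new := fr.+3 in
      Seq (copy_reg (head 0 args) cnt idx)
      (Seq (compile f (behead args) acc fr.+4)
      (Seq (Loop cnt
             (Seq (compile g [:: idx, acc & behead args] new fr.+4)
             (Seq (clear acc) (Seq (move_reg new acc) (Inc idx)))))
      (Seq (clear idx) (move_reg acc out))))
  | MMu f =>
      let idx := fr in let val := fr.+1 in let flag := fr.+2 in
      Seq (Inc flag)
      (Seq (Loop flag
             (Seq (compile f (idx :: args) val fr.+3)
               (Loop val (Seq (clear val) (Seq (Inc idx) (Inc flag))))))
        (move_reg idx out))
  end.

(** The local fixpoint of [compile] in global form, so that lemmas can speak of it. *)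
Fixpoint compile_all (args : seq nat) fr gs b :=
  if gs is g :: gs' then Seq (compile g args b fr) (compile_all args fr gs' b.+1)
  else Skip.

Lemma compile_comp f gs args out fr : compile (MComp f gs) args out fr =
  Seq (compile_all args (fr + size gs) gs fr)
    (Seq (compile f (iota fr (size gs)) out (fr + size gs))
         (clear_range fr (size gs))).
Proof.
rewrite /=; congr Seq; move: (fr + size gs) => m.
by elim: gs fr => //= g gs IH b; rewrite IH.
Qed.

Definition put (s : store) b ys : store :=
  fun x => if b <= x < b + size ys then nth 0 ys (x - b) else s x.

(** Correctness for one input and one value, uniform in the allocation of registers. The final store
    differs from [s] at [out] only, so the scratch space is zero again and can be reused by the next
    piece of code. *)
Definition compiled f xs y := forall args out fr s,
  [seq s a | a <- args] = xs -> all (fun a => a < fr) args -> out < fr ->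
  out \notin args -> (forall r, fr <= r -> s r = 0) ->
  exec (compile f args out fr) s (upd s out (s out + y)).

Definition compiled_all gs xs ys := forall args b fr s,
  [seq s a | a <- args] = xs -> all (fun a => a < b) args ->
  b + size gs <= fr -> (forall r, b <= r -> s r = 0) ->
  exec (compile_all args fr gs b) s (put s b ys).

Scheme computes_mind := Minimality for computes Sort Prop
  with computes_all_mind := Minimality for computes_all Sort Prop.


Lemma computes_all_size gs xs ys : computes_all gs xs ys -> size ys = size gs.
Proof.
by elim: gs xs ys => [|g gs IH] xs ys H; inversion H; subst => //=; rewrite (IH xs).
Qed.

Lemma compiled_primrec f g m xs (v : nat -> nat) : compiled f xs (v 0) ->
  (forall i, i < m -> compiled g [:: i, v i & xs] (v i.+1)) ->
  compiled (MPrimRec f g) (m :: xs) (v m).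
Proof.
move=> Hf Hg [|a args] //= out fr s [sa sargs] /andP[a_fr args_fr] o_fr.
rewrite in_cons negb_or => /andP[oa o_args] s0.
have not_arg r : fr <= r -> r \notin args.
  by move=> ?; apply/negP => /(allP args_fr); lia.
have args_fr4 : all (fun i => i < fr.+4) args.
  by apply: sub_all args_fr => i /=; lia.
have ext_args s' : (forall x, x < fr -> s' x = s x) -> map s' args = xs.
  move=> H; rewrite -sargs; apply/eq_in_map => i /(allP args_fr) ?.
  exact: H.
apply: exec_seq (exec_copy _ _ _ _) _; try first [lia | by apply: s0; lia].
apply: exec_seq (Hf args fr.+2 fr.+4 _ _ _ _ _ _) _ => //; try by lia.
- by apply: ext_args => x ?; upd_cases.
- by apply: not_arg; lia.
- by move=> r ?; rewrite /upd ifF ?s0 //; lia.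
(* Loop invariant at the start of round [i]: the counter holds [m - i], the accumulator [v i] and
   the index [i]. *)
pose S i : store := upd (upd (upd s fr (m - i)) fr.+2 (v i)) fr.+1 i.
have E (r : nat) : fr <= r -> s r = 0 by apply: s0.
apply: (@exec_seq _ _ _ (S m)).
  set s1 := upd _ _ _; have -> : s1 = S 0.
    apply: funext => x; rewrite /s1 /S sa; have := E fr; have := E fr.+1.
    by have := E fr.+2; upd_cases; rewrite ?H ?H0 ?H1; lia.
  (* The starting round 0 becomes an arbitrary [i], for an induction on the number of rounds
     left. *)
  move: {s1}(0) (leq0n m) => i; move Ej: (m - i) => j.
  elim: j i Ej => [|j IH] i Ej i_m.
    have -> : i = m by lia.
    by apply: exec_loop0; rewrite /S; upd_cases.
  apply: (@exec_loopS _ _ _ (S i.+1) _ j); last by apply: IH; lia.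
    by rewrite /S; upd_cases.
  have im : i < m by lia.
  apply: exec_seq (Hg i im [:: fr.+1, fr.+2 & args] fr.+3 fr.+4 _ _ _ _ _ _) _.
  - rewrite /= ext_args; first by congr [:: _, _ & _]; rewrite /S; upd_cases.
    by move=> x ?; rewrite /S; upd_cases.
  - by rewrite /= args_fr4 !ltnS; lia.
  - by lia.
  - by rewrite !in_cons !negb_or not_arg ?andbT; lia.
  - by move=> r ?; have := E r; rewrite /S; upd_cases.
  apply: exec_seq (exec_clear _ _) _.
  apply: exec_seq (exec_move _ _) _; first by lia.
  apply: exec_eq (exec_inc _ _) _ => x; have := E fr.+3.
  by rewrite /S; upd_cases.
apply: exec_seq (exec_clear _ _) (exec_eq (exec_move _ _) _); first by lia.
by move=> x; have := E fr; have := E fr.+1; have := E fr.+2; rewrite /S; upd_cases.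
Qed.

Lemma compiled_mu f xs m (v : nat -> nat) :
  (forall i, i < m -> compiled f (i :: xs) (v i).+1) ->
  compiled f (m :: xs) 0 -> compiled (MMu f) xs m.
Proof.
move=> Hlt Hm args out fr s sargs args_fr o_fr o_args s0 /=.
have not_arg r : fr <= r -> r \notin args.
  by move=> ?; apply/negP => /(allP args_fr); lia.
(* Store at the loop head, with candidate [i] and flag [b]. The inner loop clears its own counter,
   so it runs at most once: it is a conditional that raises the flag again if the value is
   nonzero. *)
pose S i b : store := upd (upd s fr i) fr.+2 b.
have E (r : nat) : fr <= r -> s r = 0 by apply: s0.
have ext_args s' : (forall x, x < fr -> s' x = s x) -> map s' args = xs.
  move=> H; rewrite -sargs; apply/eq_in_map => i /(allP args_fr) ?.
  exact: H.
have step i y : compiled f (i :: xs) y ->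
    exec (compile f (fr :: args) fr.+1 fr.+3) (S i 0) (upd (S i 0) fr.+1 y).
  move=> H; apply: exec_eq (H _ _ _ _ _ _ _ _ _) _.
  - by rewrite /= ext_args => [|x ?]; rewrite /S; [congr cons|]; upd_cases.
  - by rewrite /= ltnS; apply/andP; split; [lia|apply: sub_all args_fr => i'; lia].
  - by lia.
  - by rewrite in_cons negb_or not_arg; lia.
  - by move=> r ?; have := E r; rewrite /S; upd_cases.
  - by move=> x; have := E fr.+1; rewrite /S; upd_cases.
apply: exec_seq (exec_inc _ _) _; apply: (@exec_seq _ _ _ (S m 0)).
  set s1 := upd _ _ _; have -> : s1 = S 0 1.
    apply: funext => x; rewrite /s1 /S; have := E fr; have := E fr.+2.
    by upd_cases.
  suff H j i : m - i = j -> i <= m -> exec (Loop fr.+2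
      (Seq (compile f (fr :: args) fr.+1 fr.+3)
        (Loop fr.+1 (Seq (clear fr.+1) (Seq (Inc fr) (Inc fr.+2))))))
      (S i 1) (S m 0) by apply: (H m); lia.
  elim: j i => [|j IH] i Ej i_m; have S1 : S i 1 fr.+2 = 1 by rewrite /S; upd_cases.
    have Ei : i = m by lia.
    subst i; apply: exec_loopS S1 _ (exec_loop0 _ _).
      have -> : upd (S m 1) fr.+2 0 = S m 0.
        by apply: funext => x; rewrite /S; upd_cases.
      apply: exec_seq (step _ _ Hm) _.
      apply: exec_eq (exec_loop0 _ _) _; first by rewrite /S; upd_cases.
      by move=> x; have := E fr.+1; rewrite /S; upd_cases.
    by rewrite /S; upd_cases.
  have im : i < m by lia.
  apply: exec_loopS S1 _ (IH i.+1 _ _); try by lia.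
  have -> : upd (S i 1) fr.+2 0 = S i 0.
    by apply: funext => x; rewrite /S; upd_cases.
  apply: exec_seq (step _ _ (Hlt i im)) _.
  apply: (@exec_loopS _ _ _ (S i.+1 1) _ (v i)); first by rewrite /S; upd_cases.
    apply: exec_seq (exec_clear _ _) (exec_seq (exec_inc _ _) _).
    apply: exec_eq (exec_inc _ _) _ => x.
    by have := E fr.+1; rewrite /S; upd_cases.
  by apply: exec_loop0; have := E fr.+1; rewrite /S; upd_cases.
apply: exec_eq (exec_move _ _) _; first by lia.
by move=> x; have := E fr; have := E fr.+2; rewrite /S; upd_cases.
Qed.

(* A derivation for [MPrimRec] only gives its last value, whereas the loop of
   the compiled code needs all of them. *)
Definition primrec_values f xs y : Prop :=
  if f is MPrimRec f g then
    if xs is m :: xs then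
      exists v : nat -> nat, [/\ compiled f xs (v 0),
        forall i, i < m -> compiled g [:: i, v i & xs] (v i.+1) & v m = y]
    else True
  else True.

Lemma compiled_computes f xs y : computes f xs y -> compiled f xs y.
Proof.
move=> cf; suff [] : compiled f xs y /\ primrec_values f xs y by [].
move: f xs y cf.
apply: (@computes_mind (fun f xs y => compiled f xs y /\ primrec_values f xs y)
  compiled_all).
- move=> xs; split=> // args out fr s _ _ _ _ _.
  by apply: exec_eq (exec_skip _) _ => x; upd_cases.
- move=> x xs; split=> // -[|a args] //= out fr s [<- _] /andP[a_fr _] out_fr.
  rewrite in_cons negb_or => /andP[oa _] s0.
  apply: exec_seq (exec_copy _ _ _ _) _; try first [lia | by apply: s0].
  by apply: exec_eq (exec_inc _ _) _ => z; upd_cases.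
- move=> i xs i_xs; split=> // args out fr s def_xs /allP a_fr o_fr o_a s0; subst xs.
  rewrite size_map in i_xs; rewrite (nth_map 0) //=.
  have := a_fr _ (mem_nth 0 i_xs); have: nth 0 args i != out.
    by apply: contraNneq o_a => <-; apply: mem_nth.
  move=> /eqP no /= n_fr; apply: exec_copy => //; try lia.
  exact: s0.
- move=> f gs xs ys z cgs IHgs cf [IHf _].
  split=> // args out fr s def_xs a_fr o_fr o_a s0.
  rewrite compile_comp; have sz := computes_all_size cgs.
  have H := IHgs args fr (fr + size gs) s def_xs a_fr (leqnn _) s0.
  apply: exec_seq H _.
  have H : exec (compile f (iota fr (size gs)) out (fr + size gs)) (put s fr ys)
      (upd (put s fr ys) out (put s fr ys out + z)).
    apply: IHf.
    + apply: (@eq_from_nth _ 0) => [|i]; rewrite size_map size_iota // => i_gs.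
      rewrite (nth_map 0) ?size_iota // nth_iota // /put sz ifT; last by lia.
      by congr nth; lia.
    + by apply/allP => i; rewrite mem_iota; lia.
    + by lia.
    + by rewrite mem_iota; lia.
    + by move=> r r_fr; rewrite /put sz ifF; [apply: s0; lia | lia].
  apply: exec_seq H _; apply: exec_eq (exec_clear_range _ _ _) _ => x.
  rewrite /upd /put sz; case: ifP => H1.
    by rewrite ifF; [rewrite s0 //; lia | lia].
  by case: ifP => // _; rewrite ifF //; lia.
- move=> f g xs y _ [Hf _]; have V : primrec_values (MPrimRec f g) (0 :: xs) y.
    by exists (fun=> y); split.
  by split=> //; apply: (@compiled_primrec f g 0 xs (fun=> y)).
- move=> f g m xs y z _ [_ [v [v0 vS vm]]] _ [Hg _].
  (* The values up to [m] come from the shorter recursion, and [z] is the new one. *)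
  pose w i := if i <= m then v i else z.
  have wS i : i < m.+1 -> compiled g [:: i, w i & xs] (w i.+1).
    rewrite ltnS leq_eqVlt /w => /orP[/eqP->|im]; first by rewrite leqnn ltnn vm.
    by rewrite im ltnW //; apply: vS.
  have wm : w m.+1 = z by rewrite /w ltnn.
  have w0 : compiled f xs (w 0) by [].
  split; last by exists w; split.
  by rewrite -wm; apply: compiled_primrec.
- by move=> f xs m v _ Hlt _ [Hm _]; split=> //;
    apply: (@compiled_mu f xs m v) => // i /Hlt[].
- move=> xs args b fr s _ _ _ _; apply: exec_eq (exec_skip _) _ => x.
  by rewrite /put ifF //=; lia.
- move=> g gs xs y ys _ [Hg _] _ Hgs args b fr s sargs args_b /= b_fr s0.
  apply: exec_seq (Hg args b fr s sargs _ _ _ _) _.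
  + by apply: sub_all args_b => i; lia.
  + by lia.
  + by apply/negP => /(allP args_b); lia.
  + by move=> r ?; apply: s0; lia.
  apply: exec_eq (Hgs _ _ _ _ _ _ _ _) _.
  + rewrite -sargs; apply/eq_in_map => i /(allP args_b) ?; rewrite /upd ifF //.
    by lia.
  + by apply: sub_all args_b => i; lia.
  + by lia.
  + by move=> r ?; rewrite /upd ifF ?s0 //; lia.
  move=> x; rewrite /put /upd /= s0 // add0n.
  case: (x =P b) => [->|nxb]; first by rewrite ifF ?ifT ?subnn //; lia.
  case: (boolP (b.+1 <= x < _)) => H1; last by rewrite ifF //; lia.
  by rewrite ifT; [have -> : x - b = (x - b.+1).+1 by lia | lia].
Qed.

(** * Queue machines *)

(* [IDec r nz z] decrements [r] and jumps to [nz], or jumps to [z] if [r = 0]. *)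
Inductive instr := IInc of nat | IDec of nat & nat & nat | IJmp of nat.

(** Jump targets are absolute, whence the address [off] at which the code is placed. *)
Fixpoint flatten_com (c : com) (off : nat) : seq instr :=
  match c with
  | Skip => [::]
  | Inc r => [:: IInc r]
  | Seq c1 c2 =>
      let p := flatten_com c1 off in p ++ flatten_com c2 (off + size p)
  | Loop r c =>
      let p := flatten_com c off.+1 in
      IDec r off.+1 (off + size p).+2 :: rcons p (IJmp off)
  end.

(** The first component is 0 in the load phase and one more than the program counter afterwards. The
    second is a phase; for [IDec] it tells whether the marker has been met. *)
Definition control := (nat * nat)%type.

(* A rule reads: in control state [src], pop [pop] from the front of the queue
   and push [push] at its back, where [None] stands for no operation. *)
Definition rule := (control * option nat * option nat * control)%type.
Definition src (r : rule) := r.1.1.1.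
Definition pop (r : rule) := r.1.1.2.
Definition push (r : rule) := r.1.2.
Definition tgt (r : rule) := r.2.

(* The queue holds one marker [0] and, for each register [r], as many copies of
   [r.+1] as the register contains, in any order. [IDec] rotates the queue until
   it meets [r.+1] or has met the marker twice. *)
Definition instr_rules (K pc : nat) (i : instr) : seq rule :=
  match i with
  | IInc r => [:: ((pc.+1, 0), None, Some r.+1, (pc.+2, 0))]
  | IJmp l => [:: ((pc.+1, 0), None, None, (l.+1, 0))]
  | IDec r nz z =>
      [:: ((pc.+1, 0), Some 0, Some 0, (pc.+1, 1));
          ((pc.+1, 1), Some 0, Some 0, (z.+1, 0));
          ((pc.+1, 0), Some r.+1, None, (nz.+1, 0));
          ((pc.+1, 1), Some r.+1, None, (nz.+1, 0))] ++
      flatten [seq [:: ((pc.+1, 0), Some s, Some s, (pc.+1, 0));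
                       ((pc.+1, 1), Some s, Some s, (pc.+1, 1))]
              | s <- iota 1 K & s != r.+1]
  end.

Definition instr_reg i := match i with IInc r | IDec r _ _ => r | IJmp _ => 0 end.

Definition reg_bound (p : seq instr) := (\max_(i <- p) instr_reg i).+1.

(** This rule heads the list of rules, so that the letter 0 denotes it; the error automaton
    recognizes the end of the load phase by this letter. *)
Definition load_end : rule := ((0, 1), Some 0, Some 0, (1, 0)).
Definition load_first : rule := ((0, 0), None, Some 0, (0, 2)).
Definition load_skip : rule := ((0, 1), Some 1, Some 1, (0, 1)).
Definition load_round : rule := ((0, 1), Some 0, Some 0, (0, 2)).
Definition load_token : rule := ((0, 2), None, Some 1, (0, 1)).

(* The load phase starts with the marker alone and adds one token [1] each time
   the marker has gone round the queue. *)
Definition load_rules := [:: load_end; load_first; load_skip; load_round; load_token].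

Definition prog_rules (p : seq instr) : seq rule :=
  flatten [seq instr_rules (reg_bound p) pc (nth (IJmp 0) p pc)
          | pc <- iota 0 (size p)].

Definition machine (p : seq instr) := load_rules ++ prog_rules p.

Definition config := (control * seq nat)%type.

Definition qstep (D : seq rule) (c d : config) := exists2 r, r \in D &
  [/\ src r = c.1, tgt r = d.1 & exists2 w, c.2 = seq_of_opt (pop r) ++ w &
      d.2 = w ++ seq_of_opt (push r)].

Inductive qreach D : config -> config -> Prop :=
  | qreach0 c : qreach D c c
  | qreachS c d e : qstep D c d -> qreach D d e -> qreach D c e.

Lemma qreach_trans D c d e : qreach D c d -> qreach D d e -> qreach D c e.
Proof. by elim=> // {}c c' d' st _ IH /IH; apply: qreachS. Qed.

Lemma qreach1 D c d : qstep D c d -> qreach D c d.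
Proof. by move/qreachS; apply; apply: qreach0. Qed.

Definition repr (p : seq instr) (w : seq nat) (s : store) :=
  [/\ count_mem 0 w = 1, forall r, count_mem r.+1 w = s r &
      all (fun x => x <= reg_bound p) w].

Lemma repr_perm p w w' s : perm_eq w w' -> repr p w s -> repr p w' s.
Proof.
move=> /[dup] pw /permP cw [c0 cS]; rewrite (perm_all _ pw); split=> //.
  by rewrite -cw.
by move=> r; rewrite -cw.
Qed.

(** * Simulation of counter programs by the queue machine *)

Section Simulation.
Variable p : seq instr.
Let K := reg_bound p.
Let D := machine p.

Lemma mem_machine r pc i : pc < size p -> nth (IJmp 0) p pc = i ->
  r \in instr_rules K pc i -> r \in D.
Proof.
move=> pc_p <- r_i; rewrite mem_cat; apply/orP; right.
by apply/flatten_mapP; exists pc; rewrite ?mem_iota.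
Qed.

Lemma step_inc pc r w s : pc < size p -> nth (IJmp 0) p pc = IInc r ->
  repr p w s ->
  exists2 w', qreach D ((pc.+1, 0), w) ((pc.+2, 0), w') &
              repr p w' (upd s r (s r).+1).
Proof.
move=> pc_p pi [c0 cS aK]; exists (rcons w r.+1).
  apply: qreach1; exists ((pc.+1, 0), None, Some r.+1, (pc.+2, 0)).
    by apply: mem_machine pi _; rewrite ?mem_head.
  by split=> //; exists w; rewrite //= cats1.
have rK : r.+1 <= K.
  rewrite ltnS -[r]/(instr_reg (IInc r)) -pi.
  rewrite (big_nth (IJmp 0)) big_mkord.
  exact: (leq_bigmax (Ordinal pc_p)).
split; first by rewrite -cats1 count_cat c0.
  move=> x; rewrite -cats1 count_cat cS /= addn0 /upd eqSS eq_sym.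
  by case: eqP => [->|_]; rewrite ?addn1 ?addn0.
by rewrite all_rcons aK rK.
Qed.

Lemma step_jmp pc l w : pc < size p -> nth (IJmp 0) p pc = IJmp l ->
  qstep D ((pc.+1, 0), w) ((l.+1, 0), w).
Proof.
move=> pc_p pi; exists ((pc.+1, 0), None, None, (l.+1, 0)).
  by apply: mem_machine pi _; rewrite ?mem_head.
by split=> //; exists w; rewrite //= cats0.
Qed.

Section Dec.
Variables (pc r nz z : nat).
Hypotheses (pc_p : pc < size p) (pi : nth (IJmp 0) p pc = IDec r nz z).

Lemma rotate b w1 w2 : b < 2 -> all (fun x => x <= K) w1 -> 0 \notin w1 ->
  r.+1 \notin w1 -> qreach D ((pc.+1, b), w1 ++ w2) ((pc.+1, b), w2 ++ w1).
Proof.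
move=> b2; elim: w1 w2 => [|x w1 IH] w2; first by rewrite cats0; constructor.
rewrite /= !in_cons !negb_or => /andP[xK w1K] /andP[x0 w10] /andP[xr w1r].
apply: (@qreachS _ _ ((pc.+1, b), w1 ++ rcons w2 x)).
  exists ((pc.+1, b), Some x, Some x, (pc.+1, b)); last first.
    by split=> //; exists (w1 ++ w2); rewrite //= cats1 rcons_cat.
  apply: mem_machine pi _ => //; rewrite mem_cat; apply/orP; right.
  apply/flatten_mapP; exists x.
    by rewrite mem_filter mem_iota; lia.
  by case: b b2 {IH} => [|[|//]] _; rewrite !in_cons eqxx ?orbT.
by rewrite -cat_rcons; apply: IH.
Qed.

Lemma dec_found b w1 w2 : b < 2 -> all (fun x => x <= K) w1 -> 0 \notin w1 ->
  r.+1 \notin w1 ->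
  qreach D ((pc.+1, b), w1 ++ r.+1 :: w2) ((nz.+1, 0), w2 ++ w1).
Proof.
move=> b2 w1K w10 w1r; apply: qreach_trans (rotate _ b2 w1K w10 w1r) _.
apply: qreach1; exists ((pc.+1, b), Some r.+1, None, (nz.+1, 0)); last first.
  by split=> //; exists (w2 ++ w1); rewrite //= cats0.
apply: mem_machine pi _ => //.
by case: b b2 => [|[|//]] _; rewrite !in_cons !eqxx ?orbT.
Qed.

Lemma dec_marker b w1 w2 : b < 2 -> all (fun x => x <= K) w1 -> 0 \notin w1 ->
  r.+1 \notin w1 -> qreach D ((pc.+1, b), w1 ++ 0 :: w2)
    ((if b == 0 then (pc.+1, 1) else (z.+1, 0)), w2 ++ w1 ++ [:: 0]).
Proof.
move=> b2 w1K w10 w1r; apply: qreach_trans (rotate _ b2 w1K w10 w1r) _.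
apply: qreach1.
exists ((pc.+1, b), Some 0, Some 0, if b == 0 then (pc.+1, 1) else (z.+1, 0)).
  apply: mem_machine pi _ => //.
  by case: b b2 => [|[|//]] _; rewrite !in_cons !eqxx ?orbT.
by split=> //; exists (w2 ++ w1); rewrite //= catA.
Qed.

Lemma first_split (w : seq nat) (P : pred nat) : has P w ->
  exists w1 x w2, [/\ w = w1 ++ x :: w2, P x & ~~ has P w1].
Proof.
elim: w => //= y w IH; case Py: (P y) => /=; first by exists [::], y, w.
by move/IH => [w1 [x [w2 [-> Px w1P]]]]; exists (y :: w1), x, w2; rewrite /= Py.
Qed.

Lemma step_dec_pos w s m : repr p w s -> s r = m.+1 ->
  exists2 w', qreach D ((pc.+1, 0), w) ((nz.+1, 0), w') & repr p w' (upd s r m).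
Proof.
move=> R sr.
have fin w1 w2 : repr p (w1 ++ r.+1 :: w2) s -> repr p (w2 ++ w1) (upd s r m).
  move=> [c0 cS]; rewrite all_cat /= => /and3P[a1 _ a2]; split.
  - by move: c0; rewrite !count_cat /= addnC.
  - move=> x; have := cS x; rewrite !count_cat /= /upd eqSS eq_sym.
    by case: eqP => [->|_]; rewrite ?sr addnC /=; [case | ].
  - by rewrite all_cat a1 a2.
have [|w1 [x [w2 [Ew Px]]]] := @first_split w (predU1 0 (pred1 r.+1)).
  apply/hasP; exists r.+1; rewrite /= ?eqxx // -has_pred1 has_count.
  by case: R => _ -> _; rewrite sr.
rewrite has_predU !has_pred1 negb_or => /andP[w10 w1r].
have w1K : all (fun x => x <= K) w1 by case: R => _ _; rewrite Ew all_cat => /andP[].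
case/predU1P: Px => [x0|/eqP xr]; last first.
  rewrite xr in Ew; rewrite Ew in R *; exists (w2 ++ w1); last exact: fin.
  exact: dec_found.
(* The marker came first and has gone to the back; the search goes on in phase 1 and must succeed
   within [w2 ++ w1], before the marker returns. *)
have Rw : repr p ((w2 ++ w1) ++ [:: 0]) s.
  apply: repr_perm R; subst.
  by rewrite perm_catC cats1 perm_sym perm_rcons.
have H : 0 < count_mem r.+1 ((w2 ++ w1) ++ [:: 0]) by case: Rw => _ -> _; rewrite sr.
move: H; rewrite -has_count has_cat orbF => H.
have [w3 [y [w4 [Ew' /eqP Py]]]] := first_split H.
rewrite has_pred1 => w3r; exists ((w4 ++ [:: 0]) ++ w3).
  rewrite Ew x0; apply: qreach_trans (dec_marker _ _ _ _ _) _ => //=.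
  rewrite catA Ew' Py -catA /=; apply: dec_found => //.
    by case: Rw => _ _; rewrite Ew' -catA all_cat => /andP[].
  case: Rw => c0 _ _; apply/count_memPn.
  by move: c0; rewrite Ew' !count_cat /=; lia.
by apply: fin; rewrite -Py -cat_cons catA -Ew'.
Qed.

Lemma step_dec_zero w s : repr p w s -> s r = 0 ->
  exists2 w', qreach D ((pc.+1, 0), w) ((z.+1, 0), w') & repr p w' s.
Proof.
move=> R sr; have nr : r.+1 \notin w.
  by apply/count_memPn; case: R => _ ->.
have [|w1 [x [w2 [Ew /eqP x0]]]] := @first_split w (pred1 0).
  by rewrite has_count; case: R => ->.
rewrite has_pred1 => w10; subst x w.
have [w1r w2r] : r.+1 \notin w1 /\ r.+1 \notin w2.
  by move: nr; rewrite mem_cat in_cons !negb_or => /and3P[].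
have [w1K w2K] : all (fun x => x <= K) w1 /\ all (fun x => x <= K) w2.
  by case: R => _ _; rewrite all_cat => /and3P[].
have w20 : 0 \notin w2.
  by case: R => c0 _ _; apply/count_memPn; move: c0; rewrite count_cat /=; lia.
exists ((w2 ++ w1) ++ [:: 0]); last first.
  apply: repr_perm R; subst.
  by rewrite perm_catC cats1 perm_sym perm_rcons.
apply: qreach_trans (dec_marker _ _ _ _ _) _ => //=.
rewrite catA; apply: (@dec_marker 1 (w2 ++ w1) [::]) => //.
- by rewrite all_cat w2K w1K.
- by rewrite mem_cat negb_or w20.
- by rewrite mem_cat negb_or w2r.
Qed.

End Dec.

Definition code_at off (q : seq instr) := forall i, i < size q ->
  off + i < size p /\ nth (IJmp 0) p (off + i) = nth (IJmp 0) q i.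

Lemma code_at_cat off q1 q2 : code_at off (q1 ++ q2) ->
  code_at off q1 /\ code_at (off + size q1) q2.
Proof.
move=> H; split=> i i_q.
  by have := H i; rewrite size_cat nth_cat i_q; apply; lia.
have := H (size q1 + i); rewrite size_cat nth_cat ifF; last by lia.
by rewrite addKn addnA; apply; lia.
Qed.

Lemma simulation c s s' off w : exec c s s' -> code_at off (flatten_com c off) ->
  repr p w s ->
  exists2 w', qreach D ((off.+1, 0), w)
      (((off + size (flatten_com c off)).+1, 0), w') & repr p w' s'.
Proof.
move=> ex; elim: ex off w => {c s s'} /=.
- by move=> s off w _ R; exists w; rewrite ?addn0 //; constructor.
- move=> r s off w H R; have [] := H 0 isT; rewrite addn0 addn1.
  by move=> ? ?; apply: step_inc.
- move=> c1 c2 s1 s2 s3 _ IH1 _ IH2 off w /code_at_cat[H1 H2] R.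
  have [w1 st1 R1] := IH1 _ _ H1 R; have [w2 st2 R2] := IH2 _ _ H2 R1.
  by exists w2 => //; apply: qreach_trans st1 _; rewrite size_cat addnA.
- move=> r c s sr off w H R; have [] := H 0 isT; rewrite addn0 => h1 h2.
  by have := step_dec_zero h1 h2 R sr; rewrite size_rcons !addnS.
- move=> r c s1 s2 s3 m sr _ IH1 _ IH2 off w H R.
  have [] := H 0 isT; rewrite addn0 => h1 h2.
  have [w1 st1 R1] := step_dec_pos h1 h2 R sr.
  move: (H); rewrite -cat1s -cats1 => /code_at_cat[_] /code_at_cat[].
  rewrite /= addn1 => h3 h4; have [w2 st2 R2] := IH1 _ _ h3 R1.
  have [] := h4 0 isT; rewrite addn0 /= => h5 h6.
  have [w3 st3 R3] := IH2 off w2 H R2; exists w3 => //.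
  apply: qreach_trans st1 _; apply: qreach_trans st2 _.
  by rewrite cats1; apply: qreachS _ st3; apply: step_jmp.
Qed.

Lemma prog_rulesP r : r \in prog_rules p -> exists pc,
  [/\ pc < size p, (src r).1 = pc.+1, 0 < (tgt r).1 &
      r \in instr_rules K pc (nth (IJmp 0) p pc)].
Proof.
move=> /flatten_mapP[pc]; rewrite mem_iota => /= pc_p r_pc; exists pc.
suff [-> ->] : (src r).1 = pc.+1 /\ 0 < (tgt r).1 by [].
case: (nth _ _ _) r_pc => [x|x nz z|l] /=; rewrite ?inE.
- by move/eqP ->.
- move=> /or4P[/eqP->|/eqP->|/eqP->|/orP[/eqP->|]] //.
  by case/flatten_mapP => ? _; rewrite !inE => /orP[]/eqP->.
- by move/eqP ->.
Qed.

Lemma machineP r : r \in D -> 0 < (src r).1 -> r \in prog_rules p.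
Proof.
by rewrite mem_cat !inE -!orbA => /or4P[/eqP->|/eqP->|/eqP->|/or3P[/eqP->|/eqP->|]].
Qed.

(** The source and the popped symbol determine a rule of [IDec], which is what determinism requires
    of the only instruction with several rules. *)
Lemma dec_ruleP pc r nz z e : e \in instr_rules K pc (IDec r nz z) ->
  exists a, e = (src e, Some a, if a == r.+1 then None else Some a,
    if a == r.+1 then (nz.+1, 0) else
    if a != 0 then src e else if (src e).2 == 0 then (pc.+1, 1) else (z.+1, 0)).
Proof.
rewrite mem_cat => /orP[|/flatten_mapP[a]].
  by rewrite !inE => /or4P[]/eqP->; [exists 0|exists 0|exists r.+1|exists r.+1];
    rewrite /= ?eqxx.
rewrite mem_filter mem_iota => /andP[ar a0]; rewrite !inE => H; exists a.
have a00 : a != 0 by case: a a0 {ar H}.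
by case/orP: H => /eqP->; rewrite /= (negbTE ar) a00.
Qed.

(** The program counter selects the instruction, and for [IDec] the front of the queue selects the
    rule. The load phase is excluded, because [load_end] and [load_round] compete there. *)
Lemma machine_det c d d' : 0 < c.1.1 -> qstep D c d -> qstep D c d' -> d = d'.
Proof.
case: c d d' => s w [t v] [t' v'] /= s0 [r rD [/= sr tr [x wx vx]]].
move=> [r' rD' [/= sr' tr' [x' wx' vx']]].
suff Er : r = r'.
  subst r'; move: wx'; rewrite {1}wx => /(congr1 (drop (size (seq_of_opt (pop r))))).
  by rewrite !drop_size_cat // => Ex; rewrite vx vx' Ex -tr -tr'.
move: s0; rewrite -sr => /(machineP rD)/prog_rulesP[pc [pc_p pcr _ r_pc]].
have : 0 < (src r').1 by rewrite sr' -sr pcr.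
move/(machineP rD')/prog_rulesP => [pc' [_ pcr' _]].
have -> : pc' = pc by move: pcr'; rewrite sr' -sr pcr; case.
move: r_pc; case: (nth _ _ _) => [y|y nz z|l] /=.
- by rewrite !inE => /eqP-> /eqP->.
- move=> /dec_ruleP[a rE] /dec_ruleP[a' rE'].
  have [pa pa'] : pop r = Some a /\ pop r' = Some a' by rewrite rE rE'.
  move: wx wx'; rewrite pa pa' => -> [Ea _].
  by rewrite [LHS]rE [RHS]rE' sr sr' Ea.
- by rewrite !inE => /eqP-> /eqP->.
Qed.

End Simulation.

(** * A machine that halts or loops according to a computed value *)

Definition decision_prog g :=
  let q := flatten_com (compile g [:: 0] 1 2) 0 in
  q ++ [:: IDec 1 (size q).+2 (size q).+1; IJmp (size q).+1].

(** The address just past the last instruction, where no rule applies. [decision_prog] gets there if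
    register 1 is positive, and otherwise reaches an instruction jumping to itself. *)
Definition halt_state (p : seq instr) : control := ((size p).+1, 0).

Definition input u : store := upd (fun=> 0) 0 u.

Section Decision.
Variables (g : murec) (u : nat).
Let p := decision_prog g.
Let q := flatten_com (compile g [:: 0] 1 2) 0.

Lemma decision_run w y : computes g [:: u] y -> repr p w (input u) ->
  exists2 w', qreach (machine p) ((1, 0), w) (((size q).+1, 0), w') &
    repr p w' (upd (input u) 1 y).
Proof.
move=> /compiled_computes Hg R.
have E : exec (compile g [:: 0] 1 2) (input u) (upd (input u) 1 y).
  by apply: Hg => // -[|[|r]].
have C : code_at p 0 q.
  by move=> i i_q; rewrite /p /decision_prog size_cat nth_cat -/q i_q; split=> //; lia.
by have := simulation E C R; rewrite add0n.
Qed.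

Let q_p : (size q).+1 < size p.
Proof. by rewrite /p size_cat -/q /= addn2. Qed.

Let nth_q0 : nth (IJmp 0) p (size q) = IDec 1 (size q).+2 (size q).+1.
Proof. by rewrite /p /decision_prog -/q nth_cat ltnn subnn. Qed.

Let nth_q1 : nth (IJmp 0) p (size q).+1 = IJmp (size q).+1.
Proof. by rewrite /p /decision_prog -/q nth_cat ifF ?subSnn //; lia. Qed.

Lemma decision_halts w : computes g [:: u] 1 -> repr p w (input u) ->
  exists w', qreach (machine p) ((1, 0), w) (halt_state p, w').
Proof.
move=> cg R; have [w1 st1 R1] := decision_run cg R.
have [w2 st2 _] := step_dec_pos (ltnW q_p) nth_q0 R1 erefl.
exists w2; apply: qreach_trans st1 _; rewrite /halt_state.
by have -> : size p = (size q).+2 by rewrite /p size_cat -/q /= addn2.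
Qed.

Lemma qreach_pos c d : 0 < c.1.1 -> qreach (machine p) c d -> 0 < d.1.1.
Proof.
move=> c0 H; elim: H c0 => // {}c c' {}d [r rD [sr tr _]] _ IH.
rewrite -sr => /(machineP rD)/prog_rulesP[pc [_ _ t0 _]].
by apply: IH; rewrite -tr.
Qed.

Lemma qreach_det c d e : 0 < c.1.1 -> qreach (machine p) c d ->
  qreach (machine p) c e -> qreach (machine p) d e \/ qreach (machine p) e d.
Proof.
move=> c0 H; elim: H e c0 => [{}c|{}c c' {}d st cd IH] e c0; first by left.
move=> H; inversion H as [x Ex|x c'' y st' ce]; subst.
  by right; apply: qreachS st cd.
have E := machine_det c0 st st'; rewrite E in IH.
by apply: IH ce; apply: (@qreach_pos c) => //; apply: qreach1.
Qed.

Lemma halt_final w d : ~ qstep (machine p) (halt_state p, w) d.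
Proof.
move=> [r rD [/= sr _ _]].
have: 0 < (src r).1 by rewrite sr.
by move/(machineP rD)/prog_rulesP => [pc [pc_p]]; rewrite sr => -[E]; lia.
Qed.

(** By determinism two runs from one configuration are comparable, and here one of them arrives at a
    configuration whose only successor is itself. *)
Lemma decision_loops w w' : computes g [:: u] 0 -> repr p w (input u) ->
  ~ qreach (machine p) ((1, 0), w) (halt_state p, w').
Proof.
move=> cg R; have [w1 st1 R1] := decision_run cg R.
have [w2 st2 _] := step_dec_zero (ltnW q_p) nth_q0 R1 erefl.
have {st1 st2} st := qreach_trans st1 st2.
have loop d e : qreach (machine p) d e -> d = (((size q).+2, 0), w2) -> d = e.
  elim=> // {}d d' {}e st' _ IH Ed; subst d.
  have Ed' := machine_det (isT : 0 < ((size q).+2, 0, w2).1.1)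
    (step_jmp w2 q_p nth_q1) st'.
  by rewrite {1}Ed'; apply: IH; rewrite Ed'.
move=> /(@qreach_det ((1, 0), w) _ _ isT st) [/loop -/(_ erefl) | H].
  by rewrite /halt_state => -[E]; lia.
inversion H as [c E|c d e st' _]; subst; last exact: halt_final st'.
by lia.
Qed.

End Decision.

(** The first token follows the marker at once, hence [0 < u]; each round of the marker then adds
    one more. *)
Lemma load_reach p u : 0 < u ->
  qreach (machine p) ((0, 0), [::]) ((0, 1), 0 :: nseq u 1).
Proof.
case: u => // u _.
have mem r : r \in load_rules -> r \in machine p by move=> H; rewrite mem_cat H.
have skip m w : qreach (machine p) ((0, 1), nseq m 1 ++ w) ((0, 1), w ++ nseq m 1).
  elim: m w => [|m IH] w; first by rewrite cats0; constructor.
  apply: (@qreachS _ _ ((0, 1), nseq m 1 ++ rcons w 1)).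
    exists load_skip; first exact: mem.
    by split=> //; exists (nseq m 1 ++ w); rewrite //= cats1 rcons_cat.
  by rewrite -cat_rcons; apply: IH.
elim: u => [|u IH].
  apply: (@qreachS _ _ ((0, 2), [:: 0])).
    by exists load_first; [apply: mem|split=> //; exists [::]].
  apply: qreach1; exists load_token; first exact: mem.
  by split=> //; exists [:: 0].
apply: qreach_trans IH _.
apply: (@qreachS _ _ ((0, 2), nseq u.+1 1 ++ [:: 0])).
  by exists load_round; [apply: mem|split=> //; exists (nseq u.+1 1)].
apply: (@qreachS _ _ ((0, 1), nseq u.+1 1 ++ [:: 0; 1])).
  exists load_token; first exact: mem.
  by split=> //; exists (nseq u.+1 1 ++ [:: 0]) => //; rewrite -catA.
by apply: qreach_trans (skip _ _) _; constructor.
Qed.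

Lemma repr_input p w u : count_mem 0 w = 1 -> count_mem 1 w = u ->
  all (fun x => x < 2) w -> repr p w (input u).
Proof.
move=> c0 c1 w2; split=> //; last by apply: sub_all w2 => x; rewrite /reg_bound; lia.
case=> [|r] //=; rewrite /input /upd /=; apply/count_memPn/negP.
by move/(allP w2).
Qed.

(** * Timed runs of queue machines *)

Section TimedQueue.
Local Open Scope ring_scope.
Variables (R : realType) (D : seq rule) (halt : control).

(* Events are pairs (date, letter); the letter [a] stands for the rule [rl a]. *)
Definition event := (R * nat)%type.

Definition rl a := nth load_end D a.

Definition stamp (t : R) (o : option nat) : seq (R * nat) :=
  [seq (t, x) | x <- seq_of_opt o].

(* A symbol pushed at date [t] is popped at date [t + 1]. *)
Fixpoint treach (s : control) (T : R) (q : seq (R * nat)) (u : seq event)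
    (e : control * R * seq (R * nat)) : Prop :=
  match u with
  | [::] => (s, T, q) = e
  | (t, a) :: u' =>
      [/\ (a < size D)%N, src (rl a) = s, T < t & exists q0,
        [/\ q = stamp (t - 1) (pop (rl a)) ++ q0,
            forall p, p \in q0 -> t < p.1 + 1 &
            treach (tgt (rl a)) t (q0 ++ stamp t (push (rl a))) u' e]]
  end.

Lemma treach_cat s T q u1 u2 e : treach s T q (u1 ++ u2) e <->
  exists s1 T1 q1, treach s T q u1 (s1, T1, q1) /\ treach s1 T1 q1 u2 e.
Proof.
elim: u1 s T q => [|[t a] u1 IH] s T q /=.
  split=> [H|[s1 [T1 [q1 [[-> -> ->] //]]]]].
  by exists s, T, q.
split.
  move=> [h1 h2 h3 [q0 [h4 h5 /IH[s1 [T1 [q1 [h6 h7]]]]]]].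
  by exists s1, T1, q1; split=> //; split=> //; exists q0.
move=> [s1 [T1 [q1 [[h1 h2 h3 [q0 [h4 h5 h6]]] h7]]]]; split=> //.
by exists q0; split=> //; apply/IH; exists s1, T1, q1.
Qed.

Definition incr (T : R) (u : seq event) := path <%R T (unzip1 u).

Lemma incr_cat T u1 u2 : incr T (u1 ++ u2) =
  incr T u1 && incr (last T (unzip1 u1)) u2.
Proof. by rewrite /incr /unzip1 map_cat cat_path. Qed.

Lemma incr_gt T u p : incr T u -> p \in u -> T < p.1.
Proof.
rewrite /incr lt_path_sortedE => /andP[/allP H _] pu; apply: H.
exact: map_f.
Qed.

Lemma treach_incr s T q u e : treach s T q u e -> incr T u.
Proof.
elim: u s T q => //= [[t a] u IH] s T q [_ _ h3 [q0 [_ _ /IH h6]]].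
by rewrite /incr /= h3.
Qed.

Lemma treach_letters s T q u e : treach s T q u e ->
  all (fun p : event => p.2 < size D)%N u.
Proof.
by elim: u s T q => //= [[t a] u IH] s T q [-> _ _ [q0 [_ _ /IH]]].
Qed.

Lemma incr_mid T u1 t a v : incr T (u1 ++ (t, a) :: v) ->
  (forall p, p \in u1 -> p.1 < t) /\ (forall p, p \in v -> t < p.1).
Proof.
rewrite /incr /unzip1 map_cat cat_path /= => /and3P[i1 lt iv].
split=> p; last exact: incr_gt.
elim: u1 T i1 lt => //= [[t1 a1] u1 IH] T /= /andP[_ i1] lt.
rewrite inE => /predU1P[-> /=|]; last exact: IH i1 lt.
apply: le_lt_trans lt; have := mem_last t1 (unzip1 u1).
rewrite inE => /predU1P[->//|]; move: i1; rewrite lt_path_sortedE.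
by case/andP=> /allP H _ /H /ltW.
Qed.

(** The local reasons for not coding a halting run with load phase of length [c]: wrong ends, a
    control mismatch between neighbours, a push not answered correctly one time unit later
    ([bad_match]), a pop with no event one time unit earlier ([bad_gap] between two events,
    [bad_start] before all of them), or a wrong date for the end of the load phase. Symbols may
    remain in the queue at the end. *)
Inductive bad (c : nat) : seq event -> Prop :=
  | bad_nil : bad c [::]
  | bad_first (t : R) a u : src (rl a) != (0, 0) -> bad c ((t, a) :: u)
  | bad_last u (t : R) a : tgt (rl a) != halt -> bad c (u ++ [:: (t, a)])
  | bad_adj u1 (t : R) a (t' : R) a' u2 : tgt (rl a) != src (rl a') ->
      bad c (u1 ++ [:: (t, a), (t', a') & u2])
  | bad_match u1 (t : R) a v (t' : R) a' u2 : all (fun p : event => p.1 < t + 1) v ->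
      (t' = t + 1 /\ pop (rl a') != push (rl a)) \/
      (t + 1 < t' /\ push (rl a) != None) ->
      bad c (u1 ++ (t, a) :: v ++ (t', a') :: u2)
  | bad_gap u1 (t : R) a v (t' : R) a' u2 : t + 1 < t' ->
      all (fun p : event => t' < p.1 + 1) v -> pop (rl a') != None ->
      bad c (u1 ++ (t, a) :: v ++ (t', a') :: u2)
  | bad_start v (t' : R) a' u2 : all (fun p : event => t' < p.1 + 1) v ->
      pop (rl a') != None -> bad c (v ++ (t', a') :: u2)
  | bad_load (t : R) a v (t' : R) u2 : t' != t + c%:R ->
      bad c ((t, a) :: v ++ (t', 0%N) :: u2).

Lemma mem_stamp p t o : (p \in stamp t o) = (o == Some p.2) && (p.1 == t).
Proof.
case: o p => [x|] [t' y] //=; rewrite inE xpair_eqE andbC /=.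
by congr (_ && _); rewrite eq_sym.
Qed.

Lemma treach_popped s T q v t' a' u e : treach s T q (v ++ (t', a') :: u) e ->
  pop (rl a') != None ->
  (exists2 p, p \in q & p.1 = t' - 1) \/
  (exists2 p : event, p \in v & p.1 = t' - 1 /\ push (rl p.2) != None).
Proof.
elim: v s T q => [|[t a] v IH] s T q /= [_ _ _ [q0 [-> _ H]]] po.
  left; case: (pop (rl a')) po => // x _; exists (t' - 1, x) => //.
  by rewrite mem_cat mem_stamp /= !eqxx.
have [[p]|[p pv Hp]] := IH _ _ _ H po; last first.
  by right; exists p; rewrite // inE pv orbT.
rewrite mem_cat mem_stamp => /orP[pq p1|/andP[/eqP pp /eqP pt] p1].
  by left; exists p; rewrite // mem_cat pq orbT.
by right; exists (t, a); rewrite ?mem_head //= -pt p1 pp.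
Qed.

(** The events of [v] come too early to pop the symbol of date [t0], so it is still queued at [t'],
    where it is either popped or not yet due. *)
Lemma treach_pushed s T q v t' a' u e t0 x :
  treach s T q (v ++ (t', a') :: u) e ->
  (t0, x) \in q -> all (fun p : event => p.1 < t0 + 1) v ->
  t' <= t0 + 1 /\ (t' = t0 + 1 -> pop (rl a') = Some x).
Proof.
elim: v s T q => [|[t a] v IH] s T q /= [_ _ _ [q0 [-> le_q0 H]]].
  rewrite mem_cat mem_stamp => /orP[/andP[/eqP-> /eqP/= ->] _|/le_q0/= lt _].
    by split=> //; lra.
  by split=> [|E]; [lra | exfalso; lra].
rewrite mem_cat => Hx /andP[tt0 vt0]; apply: IH H _ vt0.
case/orP: Hx => [|xq]; last by rewrite mem_cat xq.
by rewrite mem_stamp => /andP[_ /eqP/= E]; exfalso; lra.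
Qed.

Lemma treach_not_bad c u e : treach (0, 0)%N 0 [::] u e -> e.1.1 = halt ->
  u != [::] ->
  (forall t a v t' u2, u = (t, a) :: v ++ (t', 0%N) :: u2 -> t' = t + c%:R) ->
  ~ bad c u.
Proof.
move=> H eh un Hload B; have inc := treach_incr H.
case: B H un Hload inc => {u}.
- by [].
- by move=> t a u /eqP sa [].
- move=> u t a /eqP ta /treach_cat[s1 [T1 [q1 [_ [_ _ _ [q0 [_ _ E]]]]]]].
  by move: ta; rewrite -eh -E.
- move=> u1 t a t' a' u2 /eqP ta /treach_cat[s1 [T1 [q1 [_ /= H]]]].
  by case: H => _ _ _ [q0 [_ _ []]] _ /esym.
- move=> u1 t a v t' a' u2 vt C H _ _ inc.
  have inc1 : incr 0 (u1 ++ (t, a) :: v).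
    by move: inc; rewrite -cat_cons catA incr_cat => /andP[].
  (* If [a] pushes nothing, the error is a pop at [t + 1]; its symbol was pushed at date [t], and
     [a] is the only event there. *)
  have [lt1 ltv] := incr_mid inc1; have [Ep|Ep] := eqVneq (push (rl a)) None.
    case: C; rewrite Ep => -[] // t't pp.
    rewrite -cat_cons catA in H.
    have [[//]|[p]] := treach_popped H pp; rewrite mem_cat inE => pu [p1 pn].
    case/or3P: pu => [/lt1|/eqP pE|/ltv]; [by lra| |by lra].
    by rewrite pE Ep in pn.
  case Ep': (push (rl a)) Ep C => [x|//] _ C.
  move: H => /treach_cat[s1 [T1 [q1 [_ [_ _ _ [q0 [_ _ H]]]]]]].
  have [|le E] := treach_pushed H _ vt (x := x).
    by rewrite mem_cat mem_stamp Ep' /= !eqxx orbT.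
  by case: C => [[/E ->]|[]]; [rewrite eqxx | lra].
- move=> u1 t a v t' a' u2 tt' vt pp H _ _ inc.
  have inc1 : incr 0 (u1 ++ (t, a) :: v).
    by move: inc; rewrite -cat_cons catA incr_cat => /andP[].
  have [lt1 ltv] := incr_mid inc1; rewrite -cat_cons catA in H.
  have [[//]|[p]] := treach_popped H pp; rewrite mem_cat inE => pu [p1 _].
  case/or3P: pu => [/lt1|/eqP pE|/(allP vt)]; [by lra| |by lra].
  by move: p1; rewrite pE /=; lra.
- move=> v t' a' u2 vt pp H _ _ _.
  by have [[//]|[p /(allP vt)]] := treach_popped H pp; lra.
- by move=> t a v t' u2 ne _ _ Hl _; case/eqP: ne; apply: Hl.
Qed.

(** The queue read off from the events alone: what was pushed less than one time unit before [T]. *)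
Definition window (T : R) (u : seq event) : seq (R * nat) :=
  flatten [seq stamp p.1 (push (rl p.2)) | p <- u & T < p.1 + 1].

Lemma window_cat T u1 u2 : window T (u1 ++ u2) = window T u1 ++ window T u2.
Proof. by rewrite /window filter_cat map_cat flatten_cat. Qed.

Lemma window_gt T u p : p \in window T u -> T < p.1 + 1.
Proof.
case/flatten_mapP => p'; rewrite mem_filter => /andP[Tp' _].
by rewrite mem_stamp => /andP[_ /eqP ->].
Qed.

Lemma window_nil T u :
  (forall p, p \in u -> T < p.1 + 1 -> push (rl p.2) = None) -> window T u = [::].
Proof.
elim: u => // p u IH H; rewrite -cat1s window_cat IH ?cats0; last first.
  by move=> p' p'u; apply: H; rewrite inE p'u orbT.
by rewrite /window /=; case: ifP => //= /H ->; rewrite ?mem_head.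
Qed.

Lemma window_all T T' u : all (fun p : event => T < p.1 + 1) u ->
  all (fun p : event => T' < p.1 + 1) u -> window T u = window T' u.
Proof. by move=> /all_filterP E /all_filterP E'; rewrite /window E E'. Qed.

Lemma incr_split T0 u t : incr T0 u -> exists L M,
  [/\ u = L ++ M, all (fun p : event => p.1 + 1 < t) L &
      all (fun p : event => t <= p.1 + 1) M].
Proof.
elim: u T0 => [|[t1 a1] u IH] T0; first by exists [::], [::].
rewrite /incr /= => /andP[_ inc]; have [lt|le] := ltP (t1 + 1) t.
  have [L [M [-> HL HM]]] := IH _ inc.
  by exists ((t1, a1) :: L), M; rewrite /= lt.
exists [::], ((t1, a1) :: u); split=> //=; rewrite le /=; apply/allP => p pu.
by have := incr_gt inc pu; lra.
Qed.

Lemma incr_last T u p : incr T u -> p \in u -> p.1 <= last T (unzip1 u).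
Proof.
elim: u T => //= [[t a] u IH] T; rewrite /incr /= => /andP[_ inc].
rewrite inE => /predU1P[-> /=|pu]; last exact: IH.
have := mem_last t (unzip1 u); rewrite inE => /predU1P[->//|].
by move/mapP => [p' p'u ->]; apply: ltW; apply: incr_gt inc p'u.
Qed.

(** In the absence of errors, the window loses between the last event and [t] exactly what is popped
    at [t]: a symbol due earlier would be a missed pop, one due at [t] is popped, and a pop needs an
    event at [t - 1]. *)
Lemma window_pop c u1 t a u2 : incr 0 (u1 ++ (t, a) :: u2) ->
  ~ bad c (u1 ++ (t, a) :: u2) ->
  window (last 0 (unzip1 u1)) u1 = stamp (t - 1) (pop (rl a)) ++ window t u1.
Proof.
move=> inc nb; set T := last _ _.
have [i1 Tt] : incr 0 u1 /\ T < t.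
  by move: inc; rewrite incr_cat /T => /andP[-> /andP[]].
have leT p : p \in u1 -> p.1 <= T by apply: incr_last.
have [L [M [E HL HM]]] := incr_split t i1.
(* A symbol of [L] in the window at [T] would be due strictly between [T] and [t], where there is no
   event. *)
have HL0 : window T L = [::].
  apply: window_nil => -[tp ap] pL Tp; apply/eqP/negPn/negP => pn; apply: nb.
  have Lt := allP HL _ pL; case/splitPr: pL E {HL} => L1 L2 E.
  have -> : u1 ++ (t, a) :: u2 = L1 ++ (tp, ap) :: (L2 ++ M) ++ (t, a) :: u2.
    by rewrite E -!catA.
  apply: bad_match; last by right.
  apply/allP => p pv; apply: le_lt_trans Tp; apply: leT.
  by rewrite E -catA mem_cat /= inE pv !orbT.
have HL0' : window t L = [::].
  by apply: window_nil => p /(allP HL) /= ? ?; exfalso; lra.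
have HT : all (fun p : event => T < p.1 + 1) M.
  by apply/allP => p /(allP HM); lra.
rewrite E !window_cat HL0 HL0' /= {HL0 HL0'}.
(* If no event lies at [t - 1], a pop at [t] is an error, [bad_start] or [bad_gap] according to
   whether [L] is empty. *)
have gap : all (fun p : event => t < p.1 + 1) M -> pop (rl a) = None.
  move=> HM'; apply/eqP/negPn/negP => pn; apply: nb; rewrite E -catA.
  case/lastP: L HL {E} => [|L [tp ap]] HL; first exact: bad_start.
  rewrite cat_rcons; apply: bad_gap => //.
  by move: HL; rewrite all_rcons => /andP[].
(* Dates increase, so only the first event of [M] can lie at [t - 1]. *)
case: M => [|[t1 a1] M] in E HM HT gap *; first by rewrite gap.
have i2 : forall p, p \in M -> t1 < p.1.
  by move: i1; rewrite E => /incr_mid[].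
have HM' : all (fun p : event => t < p.1 + 1) M.
  by apply/allP => p /i2; case/andP: HM => /=; lra.
have [tt1|tt1] := eqVneq t (t1 + 1); last first.
  have HM'' : all (fun p : event => t < p.1 + 1) ((t1, a1) :: M).
    by rewrite /= HM' andbT lt_neqAle tt1; case/andP: HM.
  by rewrite gap //; apply: window_all.
have Epush : pop (rl a) = push (rl a1).
  apply/eqP/negPn/negP => pn; apply: nb; rewrite E -catA cat_cons.
  apply: bad_match; last by left.
  apply/allP => p pM; rewrite -tt1; apply: le_lt_trans Tt; apply: leT.
  by rewrite E mem_cat inE pM !orbT.
case/andP: HT => HT1 HT2.
rewrite -cat1s !window_cat (window_all HT2 HM') Epush {1 3}/window /= HT1.
by rewrite tt1 ltxx /= cats0 addrK.
Qed.

Lemma good_treach c u : incr 0 u -> all (fun p : event => p.2 < size D)%N u ->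
  ~ bad c u -> exists T q, treach (0, 0)%N 0 [::] u (halt, T, q).
Proof.
move=> inc uD nb.
(* The run is rebuilt from the prefix [u1] already read: its last rule gives the control state and
   its window the queue. *)
suff H u2 u1 : u = u1 ++ u2 -> exists T q,
    treach (last (0, 0)%N [seq tgt (rl p.2) | p <- u1]) (last 0 (unzip1 u1))
      (window (last 0 (unzip1 u1)) u1) u2 (halt, T, q) by exact: (H u [::]).
elim: u2 u1 => [|[t a] u2 IH] u1 Eu.
  exists (last 0 (unzip1 u1)), (window (last 0 (unzip1 u1)) u1) => /=.
  rewrite cats0 in Eu; subst u.
  case/lastP: u1 nb {inc uD} => [[]|u1 [t a] nb]; first exact: bad_nil.
  rewrite map_rcons last_rcons /=; congr (_, _, _); apply/eqP/negPn/negP => ne.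
  by apply: nb; rewrite -cats1; apply: bad_last.
have [T [q H]] := IH (u1 ++ [:: (t, a)]) (etrans Eu (catA u1 [:: (t, a)] u2)).
exists T, q => /=; split.
- by have /(allP uD) : (t, a) \in u by rewrite Eu mem_cat mem_head orbT.
- apply/eqP/negPn/negP => ne; apply: nb; rewrite Eu.
  case/lastP: u1 ne {IH Eu H} => [|u1 [t1 a1]]; first exact: bad_first.
  by rewrite map_rcons last_rcons /= cat_rcons eq_sym; apply: bad_adj.
- by move: inc; rewrite Eu incr_cat => /andP[_ /andP[]].
exists (window t u1); split.
- by rewrite Eu in inc nb; apply: window_pop inc nb.
- by move=> p /window_gt.
move: H; rewrite map_cat last_cat /= /unzip1 map_cat last_cat /= window_cat.
rewrite {2}/window /= ifT; last by lra.
by rewrite /= cats0.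
Qed.

Lemma treach_qreach s T q u e : treach s T q u e ->
  qreach D (s, map snd q) (e.1.1, map snd e.2).
Proof.
elim: u s T q => [|[t a] u IH] s T q /=; first by move<-; constructor.
move=> [aD sa _ [q0 [-> _ /IH]]]; apply: qreachS.
exists (rl a); first exact: mem_nth.
have Es t' o : map snd (stamp t' o) = seq_of_opt o by case: o.
by split=> //; exists (map snd q0); rewrite /= map_cat Es.
Qed.

(** Invariant under which a next event can always be dated: the front symbol expires first, and
    later than [T]. *)
Definition fresh (T : R) (q : seq (R * nat)) :=
  pairwise (fun p p' : R * nat => p.1 < p'.1) q /\
  forall p, p \in q -> p.1 <= T < p.1 + 1.

(* The next date is forced if a symbol is popped; otherwise any date before the
   expiry of the front symbol will do. *)
Lemma qstep_treach r x T q : map snd q = seq_of_opt (pop r) ++ x -> fresh T q ->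
  exists t q0, [/\ q = stamp (t - 1) (pop r) ++ q0, T < t,
    (forall p, p \in q0 -> t < p.1 + 1),
    map snd (q0 ++ stamp t (push r)) = x ++ seq_of_opt (push r) &
    fresh t (q0 ++ stamp t (push r))].
Proof.
move=> qw Fq.
have [t [q0 [qE Tt tq0 F0]]] : exists t q0, [/\ q = stamp (t - 1) (pop r) ++ q0,
    T < t, (forall p, p \in q0 -> t < p.1 + 1) & map snd q0 = x /\
    pairwise (fun p p' : R * nat => p.1 < p'.1) q0].
  case: Fq => pq Fq; case: (pop r) qw => [b|] /= qw.
    case: q qw pq Fq => [//|[t0 b0] q] /= [-> qx] /andP[/allP pq0 pq] Fq.
    have /= := Fq _ (mem_head _ _) => Ft0.
    exists (t0 + 1), q; split=> //; first by rewrite addrK.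
      by lra.
    by move=> p /pq0; lra.
  case: q qw pq Fq => [|[t0 b0] q] /= qw pq Fq.
    by exists (T + 1), [::]; split=> //; lra.
  have /= Ft0 := Fq _ (mem_head _ _).
  exists ((T + (t0 + 1)) / 2), ((t0, b0) :: q); split=> //; first by lra.
  move=> p; rewrite inE => /predU1P[->/=|]; first by lra.
  by case/andP: pq => /allP pq _ /pq; lra.
have [F0x F0p] := F0; exists t, q0; split=> //.
  by rewrite map_cat F0x; case: (push r).
have q0t p : p \in q0 -> p.1 < t.
  by move=> pq0; case: Fq => _ /(_ p); rewrite qE mem_cat pq0 orbT => /(_ isT); lra.
split.
  rewrite pairwise_cat F0p; apply/and3P; split=> //; last by case: (push r).
  by apply/allrelP => p p' /q0t pt; rewrite mem_stamp => /andP[_ /eqP->].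
move=> p; rewrite mem_cat mem_stamp => /orP[pq0|/andP[_ /eqP->]]; last by lra.
by have := tq0 _ pq0; have := q0t _ pq0; lra.
Qed.

Lemma qreach_treach c d T q : qreach D c d -> map snd q = c.2 -> fresh T q ->
  exists u T' q', [/\ treach c.1 T q u (d.1, T', q'), map snd q' = d.2 & fresh T' q'].
Proof.
move=> H; elim: H T q => {c d}
  [[s w]|[s w] d e [r rD [/= sr tr [x wx dx]]] _ IH] T q /=.
  by move=> qw Fq; exists [::], T, q.
rewrite wx => qw Fq; have [t [q0 [qE Tt tq0 q0E F0]]] := qstep_treach qw Fq.
rewrite -dx in q0E; have [u [T' [q' [H1 H2 H3]]]] := IH _ _ q0E F0.
exists ((t, index r D) :: u), T', q'; split=> //=.
have Er : rl (index r D) = r by rewrite /rl nth_index.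
rewrite Er index_mem; split=> //; exists q0; split=> //.
by rewrite tr.
Qed.

End TimedQueue.

(** * The load phase *)

Section LoadPhase.
Local Open Scope ring_scope.
Variables (R : realType) (p : seq instr).
Let D := machine p.
Let halt := halt_state p.
Implicit Types (t T : R) (q : seq (R * nat)).

Lemma rl_load_end a : (a < size D)%N -> rl D a = load_end -> a = 0%N.
Proof.
case: a => // a; rewrite /rl /D /machine /= ltnS => aD E.
have : load_end \in [:: load_first; load_skip; load_round; load_token] ++ prog_rules p.
  by rewrite -E mem_nth.
by rewrite mem_cat => /orP[//|/prog_rulesP[pc []]].
Qed.

Lemma rl_load a : (a < size D)%N -> (src (rl D a)).1 = 0%N -> rl D a \in load_rules.
Proof.
move=> aD s0; have : rl D a \in D by apply: mem_nth.
rewrite mem_cat => /orP[//|/prog_rulesP[pc []]].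
by rewrite s0.
Qed.

(** Here [t1] is the date of the first event and [m] the number of completed rounds of the marker,
    last pushed at [t1 + m]. The token of the current round is present in phase 1 and still missing
    in phase 2. *)
Definition load_inv t1 m (s : control) q :=
  [/\ count_mem 0%N (map snd q) = 1%N, all (fun x => x < 2)%N (map snd q),
      (t1 + m%:R, 0%N) \in q &
      s = (0, 1)%N /\ count_mem 1%N (map snd q) = m.+1 \/
      s = (0, 2)%N /\ count_mem 1%N (map snd q) = m].

Lemma load_marker t1 m (s : control) t q0 :
  load_inv t1 m s ((t - 1, 0%N) :: q0) -> t = t1 + m.+1%:R.
Proof.
case=> c0 _ + _; rewrite inE => /predU1P[[E]|H].
  by rewrite -natr1; lra.
exfalso; move: c0 => /= [] /count_memPn/negP[].
by apply/mapP; exists (t1 + m%:R, 0%N).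
Qed.

(** A round of the marker lasts one time unit and brings one token, so at [load_end] the tokens
    count the time elapsed since [t1]. *)
Lemma load_step t1 m s q a t q0 : load_inv t1 m s q -> (a < size D)%N ->
  src (rl D a) = s -> q = stamp (t - 1) (pop (rl D a)) ++ q0 ->
  let q1 := q0 ++ stamp t (push (rl D a)) in
  [/\ a = 0%N, tgt (rl D a) = (1, 0)%N, t = t1 + m.+1%:R,
      count_mem 1%N (map snd q1) = m.+1 &
      count_mem 0%N (map snd q1) = 1%N /\ all (fun x => x < 2)%N (map snd q1)] \/
  a != 0%N /\ exists m', load_inv t1 m' (tgt (rl D a)) q1.
Proof.
move=> I aD sa qE; have s0 : s.1 = 0%N by case: I => _ _ _ [[->]|[->]].
have := @rl_load a aD; rewrite sa => /(_ s0).
have a0 r : rl D a = r -> r != load_end -> a != 0%N.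
  by move=> <-; apply: contraNneq => ->.
rewrite !inE => /orP[/eqP E|/or4P[] /eqP E]; rewrite E /= in sa qE *.
- left; subst q s; have Et := load_marker I.
  case: I => c0 c2 _ [[_ c1]|[//]]; split=> //.
  + exact: rl_load_end.
  + by move: c1; rewrite map_cat count_cat /=; lia.
  + move: c0 c2; rewrite map_cat count_cat all_cat /= => c0 ->.
    by split=> //; lia.
- by case: I => _ _ _ [[]|[]]; rewrite -sa.
- right; split; first exact: a0 E _; exists m; subst q s.
  case: I => c0 c2 c3 [[_ c1]|[//]]; split.
  + by move: c0; rewrite map_cat count_cat /=; lia.
  + by move: c2; rewrite map_cat all_cat /= => ->.
  + by rewrite mem_cat; move: c3; rewrite inE => /predU1P[//|->].
  + by left; move: c1; rewrite map_cat count_cat /=; split=> //; lia.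
- right; split; first exact: a0 E _; exists m.+1; subst q s.
  have Et := load_marker I; case: I => c0 c2 c3 [[_ c1]|[//]]; split.
  + by move: c0; rewrite map_cat count_cat /=; lia.
  + by move: c2; rewrite map_cat all_cat /= => ->.
  + by rewrite mem_cat inE Et eqxx orbT.
  + by right; move: c1; rewrite map_cat count_cat /=; split=> //; lia.
- right; split; first exact: a0 E _; exists m; subst q s.
  case: I => c0 c2 c3 [[//]|[_ c1]]; split.
  + by rewrite map_cat count_cat /= c0.
  + by rewrite map_cat all_cat /= andbT.
  + by rewrite mem_cat c3.
  + by left; rewrite map_cat count_cat c1 /= addn1.
Qed.

Lemma treach_pos s T q u e : (0 < s.1)%N -> treach D s T q u e ->
  (0 < e.1.1.1)%N /\ 0%N \notin unzip2 u.
Proof.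
elim: u s T q => [|[t a] u IH] s T q s0 /=; first by move<-.
move=> [aD sa _ [q0 [_ _ H]]]; rewrite -sa in s0.
have /prog_rulesP[pc [_ pcr t0 _]] := machineP (@mem_nth _ load_end D a aD) s0.
have [-> nu] := IH _ _ _ t0 H; split=> //; rewrite inE negb_or nu andbT.
by apply: contraL s0 => /eqP <-.
Qed.

(** The load phase is never reentered, so a run ending inside it has not fired [load_end]. *)
Lemma load_keep t1 m s T q u s' T' q' : load_inv t1 m s q ->
  treach D s T q u (s', T', q') -> s'.1 = 0%N ->
  0%N \notin unzip2 u /\ exists m', load_inv t1 m' s' q'.
Proof.
move=> + + s'0; elim: u m s T q => [|[t a] u IH] m s T q I /=.
  by case=> <- _ <-; split=> //; exists m.
move=> [aD sa _ [q0 [qE _ H]]].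
case: (load_step I aD sa qE) => [[_ ta _ _ _]|[a0 [m' I']]].
  by have [] := treach_pos _ H; rewrite ?ta ?s'0.
by have [nu I''] := IH _ _ _ _ I' H; rewrite inE negb_or eq_sym a0 nu.
Qed.

Lemma load_split t1 m s T q u e : load_inv t1 m s q ->
  treach D s T q u e -> (0 < e.1.1.1)%N -> exists v t' u' q',
  [/\ u = v ++ (t', 0%N) :: u', count_mem 0%N (map snd q') = 1%N,
      t' = t1 + (count_mem 1%N (map snd q'))%:R,
      all (fun x => x < 2)%N (map snd q') & treach D (1, 0)%N t' q' u' e].
Proof.
move=> + + e0; elim: u m s T q => [|[t a] u IH] m s T q I /=.
  by move=> E; subst e; move: e0; case: I => _ _ _ [[->]|[->]].
move=> [aD sa _ [q0 [qE _ H]]].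
case: (load_step I aD sa qE) => [[a0 ta te c1 [c0 c2]]|[a0 [m' I']]].
  exists [::], t, u, (q0 ++ stamp t (push (rl D a))).
  by rewrite ta in H; split=> //; [rewrite a0 | rewrite c1].
have [v [t' [u' [q' [-> h1 h2 h3 h4]]]]] := IH _ _ _ _ I' H.
by exists ((t, a) :: v), t', u', q'.
Qed.

Lemma load_init T u e : treach D (0, 0)%N T [::] u e -> e.1.1 <> (0, 0)%N ->
  exists t1 a u', [/\ u = (t1, a) :: u', a != 0%N,
    load_inv t1 0 (0, 2)%N [:: (t1, 0%N)] &
    treach D (0, 2)%N t1 [:: (t1, 0%N)] u' e].
Proof.
case: u => [|[t a] u] /=; first by move<-.
move=> [aD sa _ [q0 [qE _ H]]] _; exists t, a, u.
have := @rl_load a aD; rewrite sa => /(_ erefl).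
rewrite !inE => /orP[/eqP E|/or4P[] /eqP E]; rewrite E // /= in sa qE H *.
rewrite -qE /= in H; split=> //.
  by apply: contraPneq E => ->.
by split; rewrite //= ?addr0 ?mem_head //; right.
Qed.

Lemma good_of_halting c w : (0 < c)%N ->
  qreach D ((1, 0)%N, nseq c 1%N ++ [:: 0%N]) (halt, w) ->
  exists u : seq (event R), [/\ incr 0 u, all (fun x : event R => x.2 < size D)%N u &
    ~ bad D halt c u].
Proof.
move=> c0 Hh; have F0 : fresh (0 : R) [::] by [].
(* The run is dated in three pieces: the load phase, the single event [load_end], and the
   computation. *)
have [v [T1 [q1 [H1 q1E F1]]]] := 
  @qreach_treach R D _ _ 0 [::] (load_reach p c0) erefl F0.
have [t [q0 [qE Tt tq0 q0E {}F0]]] :=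
  @qstep_treach R load_end (nseq c 1%N) T1 q1 q1E F1.
have [u [T' [q' [H2 _ _]]]] := qreach_treach Hh q0E F0.
have [t1 [a [v' [vE a0 I H1']]]] := load_init H1 ltac:(by []).
have [nv [m Im]] := load_keep I H1' erefl.
have [_ nu] := @treach_pos (1, 0)%N _ _ _ _ isT H2.
have tE : t = t1 + c%:R.
  rewrite qE /= in Im; rewrite (load_marker Im); congr (_ + _%:R).
  case: Im => _ _ _ [[_ <-]|[//]]; have := q1E; rewrite qE /= => -[->].
  by rewrite count_nseq /= mul1n.
have H : treach D (0, 0)%N 0 [::] (v ++ (t, 0%N) :: u) (halt, T', q').
  apply/treach_cat; exists (0, 1)%N, T1, q1; split=> //; split=> //.
  by exists q0.
exists (v ++ (t, 0%N) :: u); split; [exact: treach_incr H|exact: treach_letters H|].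
apply: treach_not_bad H erefl _ _; first by rewrite vE.
(* The letter 0 occurs neither in [v'] nor in [u], so the given decomposition is the one at
   [load_end]. *)
move=> t2 a2 v2 t' u2; rewrite vE /= => -[<- _ E].
have : v' ++ (t, 0%N) :: u = v2 ++ (t', 0%N) :: u2 by [].
elim: v' v2 nv {vE H1' E} => [|[t3 a3] v' IH] [|[t4 a4] v2] /=.
- by move=> _ [<- _]; rewrite tE.
- by move=> _ [_ _ E]; move: nu; rewrite E /unzip2 map_cat mem_cat inE eqxx orbT.
- by move=> /[swap] -[_ -> _].
- by rewrite inE negb_or => /andP[_ nv] [_ _ E]; apply: IH E.
Qed.

Lemma halting_of_good c (u : seq (event R)) : incr 0 u ->
  all (fun x : event R => x.2 < size D)%N u -> ~ bad D halt c u ->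
  exists w w', [/\ count_mem 0%N w = 1%N, count_mem 1%N w = c,
    all (fun x => x < 2)%N w & qreach D ((1, 0)%N, w) (halt, w')].
Proof.
move=> inc uD nb; have [T [q H]] := good_treach inc uD nb.
have [t1 [a [u' [uE _ I H']]]] := load_init H ltac:(by []).
have [v [t' [u2 [q' [u'E c0 tE c2 H2]]]]] := load_split I H' isT.
exists (map snd q'), (map snd q); split=> //; last exact: treach_qreach H2.
apply/eqP; apply/negPn/negP => ne; apply: nb; rewrite uE u'E; apply: bad_load.
by rewrite tE (inj_eq (addrI _)) eqr_nat.
Qed.

End LoadPhase.

(** * Automata with absolute dates, and a language requiring n clocks *)

Section Dates.
Local Open Scope ring_scope.
Variable R : realType.

Fixpoint dates k (T : R) (w : timed_word R k) : seq (event R) :=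
  if w is (t, a) :: w' then (T + t%:num, val a) :: dates (T + t%:num) w'
  else [::].

Lemma incr_dates k T (w : timed_word R k) : incr T (dates T w).
Proof.
elim: w T => //= [[t a] w IH] T; rewrite /incr /= ltrDl [0 < _]gt0.
exact: IH.
Qed.

Lemma dates_onto k T (u : seq (event R)) : incr T u ->
  all (fun p : event R => p.2 < k)%N u -> exists w : timed_word R k, dates T w = u.
Proof.
elim: u T => [|[t a] u IH] T; first by exists [::].
rewrite /incr /= => /andP[Tt inc] /andP[ak uk].
have [w Ew] := IH t inc uk; have t0 : 0 < t - T by rewrite subr_gt0.
exists ((PosNum t0, Ordinal ak) :: w) => /=.
by rewrite addrC subrK Ew.
Qed.

(* The clock valuation is given by the dates [rho] of the last resets. *)
Fixpoint aacc k n (A : timed_automaton k n) (s : 'I_(nb_states A))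
    (rho : 'I_n -> R) (w : seq (event R)) : Prop :=
  match w with
  | [::] => s \in final A
  | (T, a) :: w' =>
      exists2 e, e \in transitions A &
        [/\ tr_source e = s, val (tr_letter e) = a,
            sat (fun x => T - rho x) (tr_guard e) &
            aacc (tr_target e) (fun x => if x \in tr_resets e then T else rho x) w']
  end.

Lemma accepts_dates k n (A : timed_automaton k n) s nu T (w : timed_word R k) :
  accepts_from s nu w <-> aacc (A := A) s (fun x => T - nu x) (dates T w).
Proof.
elim: w s nu T => [|[t a] w IH] s nu T //=.
have E : elapse nu t%:num = (fun x => T + t%:num - (T - nu x)).
  by apply: funext => x; rewrite /elapse; lra.
have Er r : (fun x => T + t%:num - reset (elapse nu t%:num) r x) =
    (fun x => if x \in r then T + t%:num else T - nu x).
  by apply: funext => x; rewrite /reset /elapse; case: ifP => _; lra.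
split=> -[e eA [se ae ge H]]; exists e => //; split=> //.
- by rewrite ae.
- by rewrite -E.
- by rewrite -Er; apply/IH.
- exact: val_inj.
- by rewrite E.
- by apply/(IH _ _ (T + t%:num)); rewrite Er.
Qed.

Lemma languageP k n (A : timed_automaton k n) (w : timed_word R k) :
  language R A w <-> exists2 s, s \in initial A & aacc (A := A) s (fun=> 0) (dates 0 w).
Proof.
have E : (fun=> 0 - 0) = (fun=> 0) :> ('I_n -> R) by apply: funext => x; lra.
split=> -[s si H]; exists s => //; last by apply/(accepts_dates _ _ 0); rewrite E.
by move/(accepts_dates _ _ 0): H; rewrite E.
Qed.

Lemma incr_catI T (u1 u2 : seq (event R)) : incr T u1 -> incr T u2 ->
  (forall p p', p \in u1 -> p' \in u2 -> p.1 < p'.1) -> incr T (u1 ++ u2).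
Proof.
move=> i1 i2 H; rewrite incr_cat i1 /=.
case: u2 i2 H => [//|[t a] u2]; rewrite /incr /= => /andP[Tt ->] H.
rewrite andbT; case/lastP: u1 {i1} H => //= u1 p H.
rewrite /unzip1 map_rcons last_rcons; apply: (H _ (t, a)); rewrite ?mem_head //.
by rewrite mem_rcons mem_head.
Qed.

Lemma incr_iota T (f : nat -> R) a b d :
  (forall l, (a <= l < a + b)%N -> T < f l) ->
  (forall l l', (a <= l)%N -> (l < l' < a + b)%N -> f l < f l') ->
  incr T [seq (f l, d) | l <- iota a b].
Proof.
elim: b a T => //= b IH a T H1 H2; rewrite /incr /= H1 ?leqnn; last by lia.
apply: IH => [l Hl|l l' Hl Hl']; apply: H2; lia.
Qed.

End Dates.

(** * What n - 1 clocks cannot recognize *)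

Section ClockBound.
Local Open Scope ring_scope.
Variables (R : realType) (k n : nat) (B : timed_automaton k n.-1).
Hypothesis n_gt0 : (0 < n)%N.
Implicit Types (rho : 'I_n.-1 -> R) (w : seq (event R)).

(** Lets the rest of an accepted word be exchanged after the prefix [w1], while keeping track of
    where the reset dates come from. *)
Lemma aacc_split s rho w1 w2 : aacc (A := B) s rho (w1 ++ w2) -> exists s' rho',
  [/\ forall x, rho' x = rho x \/ rho' x \in unzip1 w1, aacc (A := B) s' rho' w2 &
      forall w, aacc s' rho' w -> aacc s rho (w1 ++ w)].
Proof.
elim: w1 s rho => [|[t a] w1 IH] s rho /=.
  by move=> H; exists s, rho; split=> // x; left.
move=> [e eB [se ae ge /IH[s' [rho' [h1 h2 h3]]]]]; exists s', rho'; split=> //.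
  move=> x; case: (h1 x) => [->|xw]; last by right; rewrite inE xw orbT.
  by case: ifP => _; [right; rewrite mem_head | left].
by move=> w /h3 H; exists e.
Qed.

(** Guards compare single clocks with integers, so they cannot separate two values in one open
    interval between consecutive integers. *)
Definition same_cell (x y : R) :=
  exists i : nat, i%:R < x < i%:R + 1 /\ i%:R < y < i%:R + 1.

Lemma compare_same_cell o x y c : same_cell x y ->
  compare o x c%:R = compare o y c%:R.
Proof.
case=> i []; rewrite natr1; have [le|lt] := leqP c i.
  have : (c%:R <= i%:R :> R) by rewrite ler_nat.
  move=> ci /andP[ix _] /andP[iy _].
  have [xc yc] : c%:R < x /\ c%:R < y by split; lra.
  case: o => /=; rewrite ?(gt_eqF xc) ?(gt_eqF yc) //.
  - by rewrite !ltNge (ltW xc) (ltW yc).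
  - by rewrite !leNgt xc yc.
  - by rewrite (ltW xc) (ltW yc).
  - by rewrite xc yc.
have : (i.+1%:R <= c%:R :> R) by rewrite ler_nat.
move=> ci /andP[_ ix] /andP[_ iy].
have [xc yc] : x < c%:R /\ y < c%:R by split; lra.
case: o => /=; rewrite ?(lt_eqF xc) ?(lt_eqF yc) //.
- by rewrite xc yc.
- by rewrite (ltW xc) (ltW yc).
- by rewrite !leNgt xc yc.
- by rewrite !ltNge (ltW xc) (ltW yc).
Qed.

Lemma sat_same_cell N (nu nu' : valuation R N) g :
  (forall x, nu x = nu' x \/ same_cell (nu x) (nu' x)) -> sat nu g = sat nu' g.
Proof.
move=> H; elim: g => //= [x o c|g -> //|g -> g' -> //|g -> g' -> //].
by case: (H x) => [->//|]; apply: compare_same_cell.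
Qed.

Lemma aacc_same_cell s rho rho' w : aacc (A := B) s rho w ->
  (forall x, rho x = rho' x \/
     forall p, p \in w -> same_cell (p.1 - rho x) (p.1 - rho' x)) ->
  aacc s rho' w.
Proof.
elim: w s rho rho' => [//|[t a] w IH] s rho rho' /= [e eB [se ae ge H]] C.
exists e => //; split=> //.
  rewrite -(sat_same_cell (nu := fun x => t - rho x)) // => x.
  by case: (C x) => [->|/(_ _ (mem_head _ _))]; [left | right].
apply: IH H _ => x; case: ifP => _; first by left.
case: (C x) => [->|Cx]; [by left|right=> p pw].
by apply: Cx; rewrite inE pw orbT.
Qed.

(** Just after [S] no clock last reset at a date of [Z] takes an integer value, so on [(S, S + eta)]
    each of them stays in one cell. *)
Lemma common_cell (S : R) (Z : seq R) : (forall z, z \in Z -> z <= S) ->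
  exists2 eta, 0 < eta < 1 & forall z, z \in Z ->
    exists i : nat, i%:R <= S - z /\ S + eta - z < i%:R + 1.
Proof.
elim: Z => [|z Z IH] H; first by exists (1 / 2) => //; lra.
have [|eta Heta HZ] := IH; first by move=> y yZ; apply: H; rewrite inE yZ orbT.
have z0 : 0 <= S - z by rewrite subr_ge0 H ?mem_head.
have /andP[i1 i2] := truncn_itv z0; move: i2; rewrite -natr1 => i2.
set i := (Num.truncn _)%:R in i1 i2.
(* Half the distance from [S - z] to the next integer. *)
pose eta' := (i + 1 - (S - z)) / 2.
have [le|lt] := leP eta eta'.
  exists eta => // y; rewrite inE => /predU1P[->|]; last exact: HZ.
  by exists (Num.truncn (S - z)); rewrite -/i; split=> //; move: le; rewrite /eta'; lra.
exists eta'; first by move: lt; rewrite /eta'; lra.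
move=> y; rewrite inE => /predU1P[->|].
  by exists (Num.truncn (S - z)); rewrite -/i; split=> //; rewrite /eta'; lra.
by move/HZ => [j [j1 j2]]; exists j; split=> //; lra.
Qed.

(* The [n] dates [tau i] cannot all be remembered by [n - 1] clocks, and the
   date [tau i + 1] may be moved slightly if no clock remembers [tau i]. *)
Lemma clock_bound (d : nat) (u : seq (event R)) : incr 0 u ->
  ~ forall cs : seq (event R), incr 0 (u ++ cs) -> all (fun p => p.2 == d) cs ->
    (exists2 s, s \in initial B & aacc (A := B) s (fun=> 0) (u ++ cs)) <->
    size cs = n.*2 /\ forall e, (e < n)%N ->
      nth 0 (unzip1 cs) (n + e) - nth 0 (unzip1 cs) e = 1.
Proof.
move=> inc0 HB; pose S := last 0 (unzip1 u).
have S0 : 0 <= S.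
  rewrite /S; have := mem_last 0 (unzip1 u); rewrite inE => /predU1P[->//|].
  by move/mapP => [p pu ->]; apply: ltW; apply: incr_gt inc0 pu.
have leS p : p \in u -> p.1 <= S by apply: incr_last.
(* The date 0 is included for the clocks that have not been reset. *)
have [|eta /andP[eta0 eta1] HZ] := @common_cell S (0 :: unzip1 u).
  by move=> z; rewrite inE => /predU1P[->//|/mapP[p pu ->]]; apply: leS.
(* The [n] dates [tau i] are spaced by [de] inside [(S, S + eta)], with a margin [de] at both
   ends. *)
pose de := eta / n.+1%:R.
have de0 : 0 < de by rewrite divr_gt0 ?ltr0n.
pose tau i := S + de * i.+1%:R.
have tauS l : S + de <= tau l.
  by rewrite /tau -[X in S + X <= _]mulr1 lerD2l ler_pM2l // (ler_nat _ 1).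
have tau_lt l l' : (l < l')%N -> tau l + de <= tau l'.
  move=> ll'; rewrite /tau -addrA lerD2l -[X in _ + X <= _]mulr1 -mulrDr natr1.
  by rewrite ler_pM2l // ler_nat.
have tauE l : (l < n)%N -> tau l + de <= S + eta.
  move=> ln; rewrite /tau -addrA lerD2l -[X in _ + X <= _]mulr1 -mulrDr natr1.
  rewrite /de mulrAC ler_pdivrMr ?ltr0n // ler_pM2l // ler_nat ltnS.
  exact: ln.
(* [cs i T] consists of the dates [tau l] and then of the dates [tau l + 1], the one for [l = i]
   being replaced by [T]; [c2 i] and [c3 i] surround this date. *)
pose c1 := [seq (tau l, d) | l <- iota 0 n].
pose f i (T : R) l := if l == i then T else tau l + 1.
pose cs i (T : R) := c1 ++ [seq (f i T l, d) | l <- iota 0 n].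
pose c2 i := [seq (tau l + 1, d) | l <- iota 0 i].
pose c3 i := [seq (tau l + 1, d) | l <- iota i.+1 (n - i.+1)].
have csE i T : (i < n)%N -> cs i T = c1 ++ c2 i ++ (T, d) :: c3 i.
  move=> i_n; rewrite /cs /c2 /c3; congr (_ ++ _).
  have -> : iota 0 n = iota 0 i ++ i :: iota i.+1 (n - i.+1).
    have {1}-> : n = (i + (n - i.+1).+1)%N by lia.
    by rewrite iotaD.
  rewrite map_cat /= {2}/f eqxx; congr (_ ++ _ :: _); apply/eq_in_map => l;
    by rewrite mem_iota /f => ?; rewrite ifF //; lia.
have cs_tau i : cs i (tau i + 1) = c1 ++ [seq (tau l + 1, d) | l <- iota 0 n].
  by congr (_ ++ _); apply: eq_map => l; rewrite /f; case: eqP => [->|].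
have c1_mem p : p \in c1 -> exists2 l, (l < n)%N & p.1 = tau l.
  by case/mapP => l; rewrite mem_iota => /= ln ->; exists l.
have cs_incr i T : (i < n)%N -> tau i + 1 <= T < tau i + 1 + de ->
    incr 0 (u ++ cs i T).
  move=> i_n /andP[T1 T2].
  have fT l : tau l + 1 <= f i T l < tau l + 1 + de.
    by rewrite /f; case: eqP => [->|_]; lra.
  have tl l l' : (l < l')%N -> f i T l < f i T l'.
    by move=> ll'; have := fT l; have := fT l'; have := tau_lt _ _ ll'; lra.
  apply: incr_catI => //; first apply: incr_catI.
  - apply: incr_iota => [l _|l l' _ /andP[ll' _]]; first by have := tauS l; lra.
    by have := tau_lt _ _ ll'; lra.
  - apply: incr_iota => [l _|l l' _ /andP[ll' _]]; last exact: tl.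
    by have := tauS l; have := fT l; lra.
  - move=> p p' /c1_mem[l ln ->] /mapP[l' _ ->] /=.
    by have := tauE l ln; have := tauS l'; have := fT l'; lra.
  - move=> p p' /leS pS; rewrite mem_cat => /orP[/c1_mem[l _ ->]|/mapP[l _ ->] /=].
      by have := tauS l; lra.
    by have := tauS l; have := fT l; lra.
have cs_letters i T : all (fun p => p.2 == d) (cs i T).
  by apply/allP => p; rewrite mem_cat => /orP[]/mapP[l _ ->] /=.
have cs_size i T : size (cs i T) = n.*2.
  by rewrite size_cat !size_map size_iota addnn.
have cs_nth i T e : (e < n)%N -> nth 0 (unzip1 (cs i T)) (n + e) -
    nth 0 (unzip1 (cs i T)) e = f i T e - tau e.
  move=> en; rewrite /unzip1 map_cat -!map_comp !nth_cat !size_map size_iota en.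
  rewrite ifF ?addKn; last by lia.
  by rewrite !(nth_map 0%N) ?size_iota // !nth_iota.
pose w0 := [seq (tau l + 1, d) | l <- iota 0 n].
have [s si H] : exists2 s, s \in initial B & aacc (A := B) s (fun=> 0) (u ++ c1 ++ w0).
  rewrite /w0 -(cs_tau 0%N); apply/HB => //; first by apply: cs_incr => //; lra.
  split=> // e en; rewrite cs_nth // /f.
  by case: eqP => [->|_]; lra.
have := H; rewrite catA => /aacc_split[s1 [rho1 [R1 H1 K1]]].
(* Pigeonhole: the [n] distinct dates [tau l] cannot all be among the [n - 1] reset dates. *)
have [i i_n Hi] : exists2 i, (i < n)%N & forall x, rho1 x <> tau i.
  apply: contrapT => no.
  have tau_inj : injective tau.
    by move=> l l' E; case: (ltngtP l l') => // /tau_lt;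
      by rewrite E gerDl leNgt de0.
  have: (size [seq tau l | l <- iota 0 n] <= size [seq rho1 x | x <- enum 'I_n.-1])%N.
    apply: uniq_leq_size; first by rewrite map_inj_uniq ?iota_uniq.
    move=> y /mapP[l]; rewrite mem_iota => /= ln ->.
    apply: contrapT => nl; apply: no; exists l => // x E; apply: nl.
    by rewrite -E map_f ?mem_enum.
  by rewrite size_map size_iota size_map -cardE card_ord; lia.
have Ew0 : w0 = c2 i ++ (tau i + 1, d) :: c3 i.
  have := csE i (tau i + 1) i_n; rewrite cs_tau => /(congr1 (drop (size c1))).
  by rewrite !drop_size_cat.
rewrite Ew0 in H1; have [s2 [rho2 [R2 [e eB [se ae ge H3]] K2]]] := aacc_split H1.
(* A delay of half a spacing keeps the order of the events. *)
pose T' := tau i + 1 + de / 2.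
have HT' : aacc (A := B) s (fun=> 0) (u ++ cs i T').
  rewrite csE // (catA u); apply: K1; apply: K2; exists e => //; split=> //.
    rewrite -(sat_same_cell (nu := fun x => tau i + 1 - rho2 x)) // => x; right.
    have tl1 := tauS i; have tl2 := tauE i i_n.
    (* A clock reset at 0 or in [u] stays in its cell by the choice of [eta]. One reset at [tau l]
       reads more than 1 if [l < i] and less than 1 if [l > i], with or without the delay. One reset
       in [c2 i] reads less than 1. *)
    case: (R2 x) => [->|].
      have := Hi x; case: (R1 x) => [->|].
        have [j []] := HZ 0 (mem_head _ _).
        by exists j.+1; rewrite -natr1 /T'; lra.
      rewrite /unzip1 map_cat mem_cat => /orP[xu _|].
        have [|j []] := HZ (rho1 x); first by rewrite inE xu orbT.
        by exists j.+1; rewrite -natr1 /T'; lra.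
      case/mapP => p /c1_mem[l ln ->] ->.
      case: (ltngtP l i) => [li|il|-> //] _.
        by have := tau_lt _ _ li; have := tauS l; exists 1%N; rewrite /T'; lra.
      by have := tau_lt _ _ il; have := tauE l ln; exists 0%N; rewrite /T'; lra.
    case/mapP => p /mapP[l]; rewrite mem_iota => /= li -> ->.
    by have := tau_lt _ _ li; have := tauS l; exists 0%N; rewrite /T' /=; lra.
  (* A clock reset at the delayed event reads a value between 0 and 1 at all later events, with or
     without the delay. *)
  apply: aacc_same_cell H3 _ => x; case: ifP => _; last by left.
  right=> p /mapP[l]; rewrite mem_iota => /andP[il ln] -> /=; exists 0%N.
  have : (l < n)%N by lia.
  by move/tauE; have := tau_lt _ _ il; have := tauS i; rewrite /T'; lra.
have := (HB (cs i T') _ (cs_letters i T')).1 (ex_intro2 _ _ s si HT').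
case=> [|_ /(_ i i_n)]; first by apply: cs_incr => //; rewrite /T'; lra.
by rewrite cs_nth // /f eqxx /T'; lra.
Qed.

End ClockBound.

(** * Automata given by untyped transitions *)

Lemma In_mem (T : eqType) (x : T) s : List.In x s <-> x \in s.
Proof.
elim: s => //= y s IH; rewrite inE; split=> [[->|/IH->]|/predU1P[->|/IH]];
by rewrite ?eqxx ?orbT; auto.
Qed.

Lemma In_map (T T' : Type) (f : T -> T') s y :
  List.In y (map f s) <-> exists2 x, List.In x s & y = f x.
Proof.
elim: s => [|x s IH] /=; first by split=> // -[].
split=> [[<-|/IH[z zs ->]]|[z [->|zs] yE]].
- by exists x; auto.
- by exists z; auto.
- by left.
- by right; apply/IH; exists z.
Qed.

Section RawAutomata.
Local Open Scope ring_scope.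
Variables (R : realType) (n : nat) (st : Type) (num : st -> nat).

Definition arrow := (guard n * {set 'I_n} * st)%type.
Definition raw_transition := (st * nat * arrow)%type.

(** Independent of the numbers of states and letters, which can therefore be chosen afterwards from
    the codes of the transitions. *)
Definition raw_code (e : raw_transition) : nat :=
  CodeSeq.code [:: num e.1.1; e.1.2; guard_code e.2.1.1; set_code e.2.1.2; num e.2.2].

Definition of_raw k q (e : raw_transition) : transition k.+1 q.+1 n :=
  Transition (inord (num e.1.1)) (inord e.1.2) e.2.1.1 e.2.1.2 (inord (num e.2.2)).

Definition raw_automaton k q (ini fin : seq nat) (l : seq raw_transition) :
    timed_automaton k.+1 n :=
  @TimedAutomaton k.+1 n q.+1 [set i | val i \in ini] [set i | val i \in fin]
    (map (@of_raw k q) l).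

Definition raw_bounded k q (e : raw_transition) :=
  [/\ num e.1.1 <= q, e.1.2 <= k & num e.2.2 <= q]%N.

Lemma transition_code_of_raw k q e : raw_bounded k q e ->
  transition_code (@of_raw k q e) = raw_code e.
Proof.
by case=> *; rewrite /transition_code /raw_code /= !inordK.
Qed.

(** [enum] lists a set of ordinals in increasing order, so it gives back the sorted list. *)
Lemma set_code_ini q (l : seq nat) : sorted ltn l -> all (fun i => i <= q)%N l ->
  set_code [set i : 'I_q.+1 | val i \in l] = CodeSeq.code l.
Proof.
move=> l_s l_q; rewrite /set_code; congr CodeSeq.code.
apply: (@irr_sorted_eq _ ltn) => //; first exact: ltn_trans.
- by move=> x; apply: ltnn.
- rewrite sorted_map; apply: (@subseq_sorted _ _ _ _ (enum 'I_q.+1)).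
  + by move=> i j k; apply: ltn_trans.
  + by rewrite {1}/enum_mem -enumT; apply: filter_subseq.
  + by rewrite -sorted_map val_enum_ord iota_ltn_sorted.
- move=> x; apply/mapP/idP => [[i]|xl]; first by rewrite mem_enum inE => il ->.
  by exists (inord x); rewrite ?mem_enum ?inE /= inordK // ltnS; apply: (allP l_q).
Qed.

Variables (out : st -> nat -> seq arrow) (fin : seq nat).

(** The arrows form an explicit list and acceptance a disjunction over it, so that it unfolds by
    computation for a concrete automaton. *)
Fixpoint acc (s : st) (rho : 'I_n -> R) (w : seq (event R)) : Prop :=
  match w with
  | [::] => num s \in fin
  | (t, a) :: w' =>
      foldr (fun (x : arrow) P => (sat (fun y => t - rho y) x.1.1 /\
          acc x.2 (fun y => if y \in x.1.2 then t else rho y) w') \/ P)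
        False (out s a)
  end.

Lemma foldr_or T (P : T -> Prop) s :
  foldr (fun x Q => P x \/ Q) False s <-> exists2 x, List.In x s & P x.
Proof.
elim: s => [|y s IH] /=; first by split=> // -[].
split=> [[Py|/IH[x xs Px]]|[x [->|xs] Px]].
- by exists y; auto.
- by exists x; auto.
- by left.
- by right; apply/IH; exists x.
Qed.

(** The type [st] may be infinite; [ok] is a set of states closed under [out] whose numbers fit
    below the bound. *)
Lemma raw_acc k q ini l (ok : st -> Prop) s rho w : injective num ->
  (forall s, ok s -> num s <= q)%N ->
  (forall e, List.In e l -> raw_bounded k q e) ->
  (forall s a x, ok s -> List.In (s, a, x) l <-> List.In x (out s a)) ->
  (forall s a x, ok s -> List.In x (out s a) -> ok x.2) ->
  ok s -> all (fun p : event R => p.2 <= k)%N w ->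
  aacc (A := raw_automaton k q ini fin l) (inord (num s)) rho w <-> acc s rho w.
Proof.
move=> num_inj ok_q l_b lE out_ok; elim: w s rho => [|[t a] w IH] s rho oks /=.
  by rewrite inE /= inordK // ltnS ok_q.
move=> /andP[ak wk].
split=> [[e]|].
  move=> /In_mem/In_map[[[s' a'] [[g r] s'']] el ->] [/= ss' aa' gt H].
  have [/= b1 b2 b3] := l_b _ el.
  have s's : s' = s.
    have sq := ok_q _ oks; apply: num_inj.
    by move: ss' => /(congr1 val); rewrite /= !inordK.
  have a'a : a' = a by move: aa'; rewrite /= inordK.
  subst s' a'; have xo : List.In (g, r, s'') (out s a) by apply/lE.
  apply/foldr_or; exists (g, r, s'') => //; split=> //=; apply/IH => //.
  exact: (out_ok _ _ _ oks xo).
move/foldr_or => [[[g r] s''] /= xo [gt H]].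
have el : List.In (s, a, (g, r, s'')) l by apply/lE.
exists (of_raw k q (s, a, (g, r, s''))).
  by apply/In_mem/In_map; exists (s, a, (g, r, s'')).
have [/= b1 b2 b3] := l_b _ el; split=> //=; first by rewrite inordK.
by apply/IH => //; apply: (out_ok _ _ _ oks xo).
Qed.

End RawAutomata.

Arguments acc : simpl never.

(** * The error automaton *)

(* States of the automaton recognizing the words [u ++ cs], where either [u] is
   [bad] or [cs] lies in a language requiring [n] clocks: [Guess] reads the part
   of [u] before an error, [Start] looks for errors relative to the first event,
   [Found] and [Tail] follow an error, [Succ a] and [Match a] watch the
   successor and the date one unit after an event [a], [Gap] and [Gap'] guess two
   consecutive events, [First] and [Loading] measure time since the first event, and
   [Chain j] has read [j] letters of [cs]. *)
Inductive state :=
  | Guess | Start | Found | Tail | Gap | Gap' | First | Loading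
  | Chain of nat | Match of nat | Succ of nat.

(** The three infinite families are interleaved, so that numbers do not depend on the list of rules.
    The codes of the initial and final sets are thus known before the machine is built. *)
Definition num s := match s with
  | Guess => 0 | Start => 1 | Found => 2 | Tail => 3
  | Gap => 4 | Gap' => 5 | First => 6 | Loading => 7
  | Chain j => 8 + 3 * j | Match a => 9 + 3 * a | Succ a => 10 + 3 * a end.

Lemma num_inj : injective num.
Proof.
by case=> [||||||||j|j|j] [||||||||i|i|i] //=; rewrite ?plusE ?multE => E;
  first [exfalso; lia | congr Chain; lia | congr Match; lia | congr Succ; lia].
Qed.

Section ErrorAutomaton.
Variables (D : seq rule) (halt : control) (m : nat).
Let n := m.+2.

Definition clk0 : 'I_n := inord 0.
Definition clk1 : 'I_n := inord 1.

Lemma clk01 : clk0 != clk1.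
Proof. by rewrite -val_eqE /= !inordK. Qed.

Let tt := GTrue n.
Let atom x o := @GAtom n x o 1.
Definition when b (g : guard n) : guard n := if b then g else GNot tt.

Definition chain_out j : seq (arrow n state) :=
  if j < n then [:: (tt, [set inord j], Chain j.+1)]
  else if j < n.*2 then [:: (atom (inord (j - n)) OpEq, finset.set0, Chain j.+1)]
  else [::].

Definition letter_out s a : seq (arrow n state) :=
  let r := rl D a in let pops := pop r != None in
  match s with
  | Guess =>
      [:: (tt, finset.set0, Guess); (tt, finset.set0, Succ a);
          (tt, [set clk0], Match a); (tt, [set clk0], Gap);
          (when (tgt r != halt) tt, finset.set0, Tail)]
  | Start =>
      [:: (when (src r != (0, 0)) tt, finset.set0, Found);
          (when pops tt, finset.set0, Found);
          (tt, [set clk1], First); (tt, [set clk0], Loading)]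
  | Found => [:: (tt, finset.set0, Found)]
  | Gap =>
      [:: (tt, [set clk1], Gap'); (when pops (atom clk0 OpGt), finset.set0, Found)]
  | Gap' =>
      [:: (tt, finset.set0, Gap');
          (when pops (GAnd (atom clk0 OpGt) (atom clk1 OpLt)), finset.set0, Found)]
  | First =>
      [:: (tt, finset.set0, First);
          (when pops (atom clk1 OpLt), finset.set0, Found)]
  | Loading => [:: (tt, finset.set0, Loading)]
  | Match b =>
      [:: (atom clk0 OpLt, finset.set0, Match b);
          (when (pop r != push (rl D b)) (atom clk0 OpEq), finset.set0, Found);
          (when (push (rl D b) != None) (atom clk0 OpGt), finset.set0, Found)]
  | Succ b => [:: (when (tgt (rl D b) != src r) tt, finset.set0, Found)]
  | Tail | Chain _ => [::]
  end.

Definition tail_out s : seq (arrow n state) :=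
  match s with
  | Guess => chain_out 0
  | Chain j => chain_out j
  | Start | Found | Tail => [:: (tt, finset.set0, Tail)]
  | _ => [::]
  end.

(** The only transition that depends on [c]. It is kept apart because [c] will be the code of the
    list of the others. *)
Definition load_error c : arrow n state :=
  (GNot (GAtom clk0 OpEq c), finset.set0, Found).

Definition base_out s a :=
  if a < size D then letter_out s a
  else if a == size D then tail_out s else [::].

Definition out c s a : seq (arrow n state) :=
  if s is Loading then
    if a == 0 then load_error c :: base_out s a else base_out s a
  else base_out s a.

Arguments out : simpl never.

(** [Start], final because the empty word is bad, then [Found], [Tail] and the end of the chain, in
    increasing order as [set_code_ini] requires. *)
Definition finals := [:: 1; 2; 3; num (Chain n.*2)].

Local Open Scope ring_scope.
Variables (R : realType) (c : nat).
Hypothesis D0 : (0 < size D)%N.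
Implicit Types (rho : 'I_n -> R) (u w cs : seq (event R)).

Local Notation acc := (@acc R n state num (out c) finals).
Local Notation rl := (rl D).
Definition is_tail cs := all (fun p : event R => p.2 == size D) cs.
Definition is_word u := all (fun p : event R => p.2 < size D)%N u.

Lemma reset_set0 (t : R) rho :
  (fun y => if y \in (finset.set0 : {set 'I_n}) then t else rho y) = rho.
Proof. by apply: funext => y; rewrite finset.in_set0. Qed.

Definition upd_clk rho (x : 'I_n) t : 'I_n -> R := fun y => if y == x then t else rho y.

Lemma reset_set1 (t : R) rho x :
  (fun y => if y \in [set x]%SET then t else rho y) = upd_clk rho x t.
Proof. by apply: funext => y; rewrite finset.in_set1. Qed.

Lemma sat_when b g (nu : valuation R n) : sat nu (when b g) = b && sat nu g.
Proof. by case: b. Qed.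

Lemma clk_lt (t x : R) : (t - x < 1) = (t < x + 1).
Proof. by apply/idP/idP => ?; lra. Qed.

Lemma clk_gt (t x : R) : (1 < t - x) = (x + 1 < t).
Proof. by apply/idP/idP => ?; lra. Qed.

Lemma out_letter s a : (a < size D)%N -> out c s a =
  if s is Loading then if a == 0%N then load_error c :: letter_out s a else letter_out s a
  else letter_out s a.
Proof. by move=> aD; rewrite /out /base_out aD; case: s. Qed.

Lemma out_tail s : out c s (size D) = tail_out s.
Proof.
rewrite /out /base_out ltnn eqxx; case: s => //.
by rewrite eqn0Ngt D0.
Qed.

Lemma out_none s a : (size D < a)%N -> out c s a = [::].
Proof.
move=> Da; rewrite /out /base_out; have -> : (a < size D)%N = false by lia.
by have -> : (a == size D) = false; [lia | case: s => //; rewrite ifF //; lia].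
Qed.

Lemma acc_cons s rho t a w : acc s rho ((t, a) :: w) =
  foldr (fun (x : arrow n state) P => (sat (fun y => t - rho y) x.1.1 /\
      acc x.2 (fun y => if y \in x.1.2 then t else rho y) w) \/ P)
    False (out c s a).
Proof. by []. Qed.

Lemma acc_Tail rho cs : is_tail cs -> acc Tail rho cs.
Proof.
elim: cs rho => [//|[t a] cs IH] rho /andP[/eqP /= -> tl].
by rewrite acc_cons out_tail /= reset_set0; left; split=> //; apply: IH.
Qed.

Lemma acc_Found rho u cs : is_word u -> is_tail cs -> acc Found rho (u ++ cs).
Proof.
elim: u rho => [|[t a] u IH] rho /=.
  case: cs => [//|[t a] cs] _ /andP[/eqP/= -> tl].
  by rewrite acc_cons out_tail /= reset_set0; left; split=> //; apply: acc_Tail.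
move=> /andP[/= aD uD] tl; rewrite acc_cons out_letter //= reset_set0.
by left; split=> //; apply: IH.
Qed.

Lemma acc_Tail_nil rho u cs : is_word u -> acc Tail rho (u ++ cs) -> u = [::].
Proof. by case: u => // [[t a] u] /andP[/= aD _]; rewrite acc_cons out_letter. Qed.

Lemma not_acc_tail s rho cs : is_tail cs ->
  match s with Gap | Gap' | First | Loading | Match _ | Succ _ => True | _ => False end ->
  ~ acc s rho cs.
Proof.
case: cs => [|[t a] cs] /=; last first.
  by case/andP=> /eqP-> _; rewrite acc_cons out_tail; case: s => //= *; case.
move=> _ st; change (~ (num s \in finals)); case: s st => //= [i|i] _.
  by rewrite /finals /= !inE -addnn; lia.
by rewrite /finals /= !inE -addnn; lia.
Qed.

(** Common analysis of the states that loop under a condition [L], leaving the clocks alone, until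
    an error [E] sends them to [Found]. *)
Lemma acc_loop s (L E : ('I_n -> R) -> R -> nat -> Prop) :
  (forall rho t a w, (a < size D)%N -> acc s rho ((t, a) :: w) <->
     (L rho t a /\ acc s rho w) \/ (E rho t a /\ acc Found rho w)) ->
  match s with Gap | Gap' | First | Loading | Match _ | Succ _ => True | _ => False end ->
  forall rho u cs, is_word u -> is_tail cs -> acc s rho (u ++ cs) <->
    exists v t a u2, [/\ u = v ++ (t, a) :: u2,
      forall p, p \in v -> L rho p.1 p.2 & E rho t a].
Proof.
move=> step st rho u cs + tl; elim: u => [|[t a] u IH] /=.
  by move=> _; split=> [/(not_acc_tail tl st)//|[[|p v] [? [? [? []]]]]].
move=> /andP[/= aD uD]; rewrite step //; split.
  case=> [[La /(IH uD)[v [t' [a' [u2 [-> Lv Ea]]]]]]|[Ea _]].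
    exists ((t, a) :: v), t', a', u2; split=> // p.
    by rewrite inE => /predU1P[->|/Lv].
  by exists [::], t, a, u.
move=> [[|p v] [t' [a' [u2 [/= Eu Lv Ea]]]]].
  by case: Eu Ea => <- <- _ Ea; right; split=> //; apply: acc_Found.
case: Eu Lv => <- Eu Lv; left; split; first exact: (Lv _ (mem_head _ _)).
apply/IH => //; exists v, t', a', u2; split=> // p' p'v.
by apply: Lv; rewrite inE p'v orbT.
Qed.

Lemma acc_Match b rho u cs : is_word u -> is_tail cs ->
  acc (Match b) rho (u ++ cs) <-> exists v t a u2, [/\ u = v ++ (t, a) :: u2,
    all (fun p : event R => p.1 < rho clk0 + 1) v &
    (t = rho clk0 + 1 /\ pop (rl a) != push (rl b)) \/
    (rho clk0 + 1 < t /\ push (rl b) != None)].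
Proof.
move=> uD tl; rewrite (@acc_loop (Match b) (fun rho t _ => t < rho clk0 + 1)
  (fun rho t a => (t = rho clk0 + 1 /\ pop (rl a) != push (rl b)) \/
    (rho clk0 + 1 < t /\ push (rl b) != None))) //.
  split=> -[v [t [a [u2 [-> Lv Ea]]]]]; exists v, t, a, u2; split=> //.
    by apply/allP => p /Lv.
  by move=> p /(allP Lv).
move=> {}rho t a w aD; rewrite acc_cons out_letter //= !sat_when !reset_set0 /=.
have -> : (t - rho clk0 == 1) = (t == rho clk0 + 1) by rewrite subr_eq addrC.
rewrite clk_lt clk_gt; split.
  case=> [[Lt H]|[[/andP[pp /eqP te] H]|[[/andP[pn Gt] H]|[]]]]; first by left.
    by right; split=> //; left.
  by right; split=> //; right.
case=> [[Lt H]|[[[-> pp]|[Gt pn]] H]]; first by left.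
  by right; left; rewrite eqxx pp.
by do 2!right; left; rewrite Gt pn.
Qed.

Lemma acc_Gap' rho u cs : is_word u -> is_tail cs ->
  acc Gap' rho (u ++ cs) <-> exists v t a u2, [/\ u = v ++ (t, a) :: u2,
    pop (rl a) != None & rho clk0 + 1 < t < rho clk1 + 1].
Proof.
move=> uD tl; rewrite (@acc_loop Gap' (fun _ _ _ => True)
  (fun rho t a => pop (rl a) != None /\ rho clk0 + 1 < t < rho clk1 + 1)) //.
  by split=> -[v [t [a [u2 []]]]]; [move=> -> _ [] | move=> -> ? ?];
    exists v, t, a, u2.
move=> {}rho t a w aD; rewrite acc_cons out_letter //= !sat_when !reset_set0 /=.
rewrite clk_lt clk_gt; split.
  by case=> [[_ H]|[[/and3P[h1 h2 h3] H]|[]]]; [left | right; rewrite h1 h2 h3].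
by case=> [[_ H]|[[h1 h2] H]]; [left | right; left; rewrite h1 h2].
Qed.

Lemma acc_First rho u cs : is_word u -> is_tail cs ->
  acc First rho (u ++ cs) <-> exists v t a u2, [/\ u = v ++ (t, a) :: u2,
    pop (rl a) != None & t < rho clk1 + 1].
Proof.
move=> uD tl; rewrite (@acc_loop First (fun _ _ _ => True)
  (fun rho t a => pop (rl a) != None /\ t < rho clk1 + 1)) //.
  by split=> -[v [t [a [u2 []]]]]; [move=> -> _ [] | move=> -> ? ?];
    exists v, t, a, u2.
move=> {}rho t a w aD; rewrite acc_cons out_letter //= !sat_when !reset_set0 /=.
rewrite clk_lt; split.
  by case=> [[_ H]|[[/andP[h1 h2] H]|[]]]; [left | right; rewrite h1 h2].
by case=> [[_ H]|[[h1 h2] H]]; [left | right; left; rewrite h1 h2].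
Qed.

Lemma acc_Loading rho u cs : is_word u -> is_tail cs ->
  acc Loading rho (u ++ cs) <-> exists v t u2, u = v ++ (t, 0%N) :: u2 /\
    t != rho clk0 + c%:R.
Proof.
move=> uD tl; rewrite (@acc_loop Loading (fun _ _ _ => True)
  (fun rho t a => a = 0%N /\ t != rho clk0 + c%:R)) //.
  split=> [[v [t [a [u2 []]]]] -> _ [-> H]|[v [t [u2 []]]] -> H];
  by [exists v, t, u2 | exists v, t, 0%N, u2].
move=> {}rho t a w aD; rewrite acc_cons out_letter //=.
case: (a =P 0%N) => [a0|na0] /=; rewrite !reset_set0 /= ?subr_eq ?[c%:R + _]addrC; split.
- by case=> [[h H]|[[_ H]|[]]]; [right | left].
- by case=> [[_ H]|[[_ h] H]]; [right; left | left].
- by case=> [[_ H]|[]]; left.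
- by case=> [[_ H]|[[]]]; left.
Qed.

Lemma acc_Succ b rho u cs : is_word u -> is_tail cs ->
  acc (Succ b) rho (u ++ cs) <-> exists t a u2, u = (t, a) :: u2 /\
    tgt (rl b) != src (rl a).
Proof.
case: u => [|[t a] u] uD tl.
  by split=> [/(@not_acc_tail (Succ b) _ _ tl I)//|[? [? [? []]]]].
case/andP: uD => /= aD uD; rewrite acc_cons out_letter //= sat_when reset_set0; split.
  by case=> [[/andP[H _] _]|[]]; exists t, a, u.
case=> t' [a' [u2 [[_ -> _] ->]]]; left; split=> //; exact: acc_Found.
Qed.

Lemma acc_Gap rho u cs : is_word u -> is_tail cs -> acc Gap rho (u ++ cs) <->
  exists t a u2, u = (t, a) :: u2 /\
    (pop (rl a) != None /\ rho clk0 + 1 < t \/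
     exists v t' a' u3, [/\ u2 = v ++ (t', a') :: u3, pop (rl a') != None &
       rho clk0 + 1 < t' < t + 1]).
Proof.
case: u => [|[t a] u] uD tl.
  by split=> [/(@not_acc_tail Gap _ _ tl I)//|[? [? [? []]]]].
case/andP: uD => /= aD uD; rewrite acc_cons out_letter //= sat_when reset_set0 reset_set1 /=.
rewrite acc_Gap' // /upd_clk eqxx (negbTE clk01) clk_gt; split.
  case=> [[_ H]|[[/andP[h1 h2] _]|[]]]; exists t, a, u; split=> //; [by right|].
  by left.
case=> t' [a' [u2 [[<- <- <-] [[h1 h2]|H]]]]; last by left.
by right; left; rewrite h1 h2; split=> //; apply: acc_Found.
Qed.

Lemma acc_Guess rho u cs : is_word u -> is_tail cs -> acc Guess rho (u ++ cs) <->
  (exists u1 t a u2, u = u1 ++ (t, a) :: u2 /\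
    [\/ acc (Succ a) rho (u2 ++ cs), acc (Match a) (upd_clk rho clk0 t) (u2 ++ cs),
        acc Gap (upd_clk rho clk0 t) (u2 ++ cs) | tgt (rl a) != halt /\ u2 = [::]]) \/
  acc Guess rho cs.
Proof.
move=> + tl; elim: u => [|[t a] u IH] uD.
  by split=> [|[[[|? ?] [? [? [? []]]]]|]] //; right.
case/andP: uD => /= aD uD; rewrite acc_cons out_letter //= sat_when !reset_set0 !reset_set1.
split.
  case=> [[_ /(IH uD)[[u1 [t' [a' [u2 [-> H]]]]]|H]]|H]; last 1 first.
  - left; exists [::], t, a, u; split=> //.
    case: H => [[_ H]|[[_ H]|[[_ H]|[[/andP[h _] H]|[]]]]].
    + by constructor 1.
    + by constructor 2.
    + by constructor 3.
    + by constructor 4; split=> //; apply: acc_Tail_nil uD H.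
  - by left; exists ((t, a) :: u1), t', a', u2.
  - by right.
case=> [[[|p u1] [t' [a' [u2 [/= E H]]]]]|H].
- case: E H => <- <- <- [H|H|H|[h u0]]; [by right; left|by do 2!right; left|..].
    by do 3!right; left.
  by do 4!right; left; rewrite h u0; split=> //; apply: acc_Tail.
- case: E => _ E; left; split=> //; apply/IH => //; left.
  by exists u1, t', a', u2.
- by left; split=> //; apply/IH => //; right.
Qed.

Lemma acc_Start rho u cs : is_word u -> is_tail cs -> acc Start rho (u ++ cs) <->
  u = [::] \/ exists t a u2, u = (t, a) :: u2 /\
    [\/ src (rl a) != (0, 0)%N, pop (rl a) != None,
        acc First (upd_clk rho clk1 t) (u2 ++ cs) |
        acc Loading (upd_clk rho clk0 t) (u2 ++ cs)].
Proof.
case: u => [|[t a] u] uD tl.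
  split=> _; first by left.
  case: cs tl => [//|[t a] cs] /andP[/eqP/= -> tl].
  by rewrite acc_cons out_tail /= reset_set0; left; split=> //; apply: acc_Tail.
case/andP: uD => /= aD uD; rewrite acc_cons out_letter //= !sat_when !reset_set0 !reset_set1.
split.
  case=> [[/andP[h _] H]|[[/andP[h _] H]|[[_ H]|[[_ H]|[]]]]]; right;
  exists t, a, u; split=> //.
  + by constructor 1.
  + by constructor 2.
  + by constructor 3.
  + by constructor 4.
case=> // -[t' [a' [u2 [[<- <- <-] [h|h|H|H]]]]].
- by left; rewrite h; split=> //; apply: acc_Found.
- by right; left; rewrite h; split=> //; apply: acc_Found.
- by do 2!right; left.
- by do 3!right; left.
Qed.

Lemma is_word_suffix u1 p u2 : is_word (u1 ++ p :: u2) -> is_word u2.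
Proof. by rewrite /is_word all_cat /= => /and3P[]. Qed.

(** From [Guess], the states [Succ], [Match], [Gap] and [Tail] detect [bad_adj], [bad_match],
    [bad_gap] and [bad_last]. The other errors concern the beginning of the word and are found from
    [Start]. *)
Lemma acc_bad u cs : incr 0 u -> is_word u -> is_tail cs ->
  acc Guess (fun=> 0) (u ++ cs) \/ acc Start (fun=> 0) (u ++ cs) <->
  bad D halt c u \/ acc Guess (fun=> 0) cs.
Proof.
move=> inc uD tl; rewrite acc_Guess // acc_Start //; split.
  case=> [[[u1 [t [a [u2 [E H]]]]]|H]|[->|[t [a [u2 [E H]]]]]].
  - have u2D : is_word u2 by rewrite E in uD; apply: is_word_suffix uD.
    have [_ inc2] : (forall p, p \in u1 -> p.1 < t) /\ (forall p, p \in u2 -> t < p.1).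
      by apply: (@incr_mid R 0 u1 t a u2); rewrite -E.
    left; rewrite E; case: H.
    + move/acc_Succ => /(_ u2D tl)[t' [a' [u3 [-> ne]]]].
      exact: bad_adj.
    + move/acc_Match => /(_ u2D tl)[v [t' [a' [u3 [-> vt H]]]]].
      by rewrite /upd_clk eqxx in vt H; apply: bad_match.
    + move/acc_Gap => /(_ u2D tl)[t' [a' [u3 [E2]]]]; rewrite /upd_clk eqxx.
      case=> [[pp lt]|[v [t2 [a2 [u4 [E3 pp /andP[lt1 lt2]]]]]]].
        by rewrite E2; apply: (@bad_gap R D halt c u1 t a [::]).
      rewrite E2 E3; apply: (@bad_gap R D halt c u1 t a ((t', a') :: v)) => //=.
      (* Only the event right after the guessed one is tested; the later ones are closer still. *)
      rewrite lt2; apply/allP => p pv.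
      have : incr 0 ((u1 ++ [:: (t, a)]) ++ (t', a') :: v ++ (t2, a2) :: u4).
        by rewrite -catA /= -E3 -E2 -E.
      case/incr_mid => _ /(_ p); rewrite mem_cat pv => /(_ isT); lra.
    + by case=> ne ->; apply: bad_last.
  - by right.
  - by left; apply: bad_nil.
  - have u2D : is_word u2 by move: uD; rewrite E => /andP[].
    left; rewrite E; case: H => [ne|pp||].
    + exact: bad_first.
    + exact: (@bad_start R D halt c [::]).
    + move/acc_First => /(_ u2D tl)[v [t' [a' [u3 [E2 pp]]]]]; rewrite /upd_clk eqxx => lt.
      rewrite E2; apply: (@bad_start R D halt c ((t, a) :: v)) => //=.
      rewrite lt; apply/allP => p pv.
      have : incr 0 ([::] ++ (t, a) :: u2) by rewrite -E.
      case/incr_mid => _ /(_ p); rewrite E2 mem_cat pv => /(_ isT); lra.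
    + move/acc_Loading => /(_ u2D tl)[v [t' [u3 [E2 ne]]]]; rewrite /upd_clk eqxx in ne.
      by rewrite E2; apply: bad_load.
case=> [B|H]; last by left; right.
case: B inc uD => {u}.
- by right; left.
- by move=> t a u ne _ _; right; right; exists t, a, u; split=> //; constructor 1.
- move=> u t a ne _ _; left; left; exists u, t, a, [::]; split=> //.
  by constructor 4.
- move=> u1 t a t' a' u2 ne _ uD; left; left; exists u1, t, a, ((t', a') :: u2).
  split=> //; constructor 1; apply/acc_Succ => //.
    by apply: is_word_suffix uD.
  by exists t', a', u2.
- move=> u1 t a v t' a' u2 vt H _ uD; left; left.
  exists u1, t, a, (v ++ (t', a') :: u2); split=> //; constructor 2.
  apply/acc_Match => //; first by apply: is_word_suffix uD.
  by exists v, t', a', u2; rewrite /upd_clk eqxx.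
- move=> u1 t a v t' a' u2 tt' vt pp _ uD; left; left.
  exists u1, t, a, (v ++ (t', a') :: u2); split=> //; constructor 3.
  apply/acc_Gap => //; first by apply: is_word_suffix uD.
  rewrite /upd_clk eqxx; case: v vt {uD} => [|[t2 a2] v] /=.
    by exists t', a', u2; split=> //; left.
  case/andP=> lt vt; exists t2, a2, (v ++ (t', a') :: u2); split=> //; right.
  by exists v, t', a', u2; rewrite tt' lt.
- move=> [|[t a] v] t' a' u2 vt pp _ uD; right; right.
    by exists t', a', u2; split=> //; constructor 2.
  exists t, a, (v ++ (t', a') :: u2); split=> //; constructor 3.
  apply/acc_First => //; first by case/andP: uD.
  by exists v, t', a', u2; rewrite /upd_clk eqxx; split=> //; case/andP: vt.
- move=> t a v t' u2 ne _ uD; right; right.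
  exists t, a, (v ++ (t', 0%N) :: u2); split=> //; constructor 4.
  apply/acc_Loading => //; first by case/andP: uD.
  by exists v, t', u2; rewrite /upd_clk eqxx.
Qed.

(** The tail letter leads only to [Tail] and [Chain] states, which read no rule letter. *)
Lemma acc_shape s rho w : acc s rho w -> exists u cs,
  [/\ w = u ++ cs, is_word u, is_tail cs &
      match s with Tail | Chain _ => u = [::] | _ => True end].
Proof.
elim: w s rho => [|[t a] w IH] s rho.
  by move=> _; exists [::], [::]; split=> //; case: s.
rewrite acc_cons => /foldr_or[x xo [_ /IH[u [cs [-> uD tl sh]]]]].
case: (ltngtP a (size D)) => [aD|Da|aE].
- exists ((t, a) :: u), cs; rewrite /is_word /= aD; split=> //.
  by move: xo; rewrite out_letter //; case: s.
- by rewrite out_none in xo.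
- rewrite aE out_tail in xo; have u0 : u = [::].
    have chain j : List.In x (chain_out j) -> u = [::].
      by rewrite /chain_out; case: ifP => _ /=; [|case: ifP => _ //=];
        case=> // xE; rewrite -xE in sh.
    case: s xo => [||||||||j|j|j] //= xo; try exact: chain xo;
    by case: xo => // xE; rewrite -xE in sh.
  exists [::], ((t, a) :: cs); rewrite u0 /is_tail /= aE eqxx.
  by split=> //; case: s {xo}.
Qed.

(** [Guess] acts as the state in which no tail letter has been read. *)
Definition chain j := if j is 0%N then Guess else Chain j.

(** After [j] letters, the date of letter [e] is stored in clock [e] if [e < j] and is still to be
    read otherwise; the comparisons left are those with [j <= n + e]. *)
Lemma acc_chain j rho cs : is_tail cs -> acc (chain j) rho cs <->
  (j + size cs = n.*2)%N /\ forall e, (e < n)%N -> (j <= n + e)%N ->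
    nth 0 (unzip1 cs) (n + e - j) -
      (if (e < j)%N then rho (inord e) else nth 0 (unzip1 cs) (e - j)) = 1.
Proof.
elim: cs j rho => [|[t a] cs IH] j rho.
  have -> : acc (chain j) rho [::] = (num (chain j) \in finals) :> Prop by [].
  move=> _; rewrite addn0; split.
    case: j => [//|j] jE; have E : j.+1 = n.*2.
      by move: jE; rewrite /finals /= !inE -addnn; lia.
    by split=> // e en; rewrite E -addnn; lia.
  by case=> -> _; rewrite /finals !inE eqxx !orbT.
case/andP=> /eqP/= -> tl; rewrite acc_cons out_tail.
have -> : tail_out (chain j) = chain_out j by case: j.
rewrite /chain_out; case: ltnP => [jn|nj] /=.
  rewrite reset_set1; split.
    case=> [[_ /(IH j.+1)[//|sz H]]|[]]; split; first by lia.
    move=> e en je; have := H e en; case: (ltngtP e j) => [ej|je'|ej].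
    + have -> : (e < j.+1)%N by lia.
      rewrite /upd_clk ifF; last by rewrite -val_eqE /= !inordK; lia.
      have -> : (n + e - j)%N = (n + e - j.+1).+1 by lia.
      by apply; lia.
    + have -> : (e < j.+1)%N = false by lia.
      have -> : (n + e - j)%N = (n + e - j.+1).+1 by lia.
      have -> : (e - j)%N = (e - j.+1).+1 by lia.
      by apply; lia.
    + rewrite ej ltnSn /upd_clk eqxx subnn /=.
      have -> : (n + j - j)%N = (n + j - j.+1).+1 by lia.
      by apply; lia.
  case=> sz H; left; split=> //; apply/(IH j.+1) => //; split; first by lia.
  move=> e en je; have je1 : (j <= n + e)%N by lia.
  have := H e en je1; have -> : (n + e - j)%N = (n + e - j.+1).+1 by lia.
  rewrite /=; case: (ltngtP e j) => [ej|je'|ej].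
  + have -> : (e < j.+1)%N by lia.
    by rewrite /upd_clk ifF //; rewrite -val_eqE /= !inordK; lia.
  + have -> : (e < j.+1)%N = false by lia.
    by have -> : (e - j)%N = (e - j.+1).+1 by lia.
  + by rewrite ej ltnSn /upd_clk eqxx subnn.
case: ltnP => [jn2|nj2] /=; last first.
  by split=> // -[sz _]; move: nj2; rewrite -sz; lia.
rewrite reset_set0; split.
  case=> [[/eqP gt /(IH j.+1)[//|sz H]]|[]]; split; first by lia.
  move=> e en je; have [jE|jE] := eqVneq j (n + e)%N.
    rewrite ifT; last by lia.
    rewrite -jE subnn /=; move: gt.
    by have -> : (j - n)%N = e by lia.
  have := H e en; have -> : (e < j.+1)%N by lia.
  have -> : (e < j)%N by lia.
  have -> : (n + e - j)%N = (n + e - j.+1).+1 by lia.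
  by apply; lia.
case=> sz H; left; split.
  have h1 : (j - n < n)%N by rewrite -addnn in jn2; lia.
  have h2 : (j <= n + (j - n))%N by lia.
  have := H _ h1 h2; rewrite ifT; last by lia.
  have -> : (n + (j - n) - j = 0)%N by lia.
  by move=> /= ->.
apply/(IH j.+1) => //; split; first by lia.
move=> e en je; have je1 : (j <= n + e)%N by lia.
have := H e en je1; have -> : (n + e - j)%N = (n + e - j.+1).+1 by lia.
have -> : (e < j.+1)%N by lia.
by have -> : (e < j)%N by lia.
Qed.

Lemma acc_tail rho cs : is_tail cs -> acc Guess rho cs <->
  size cs = n.*2 /\ forall e, (e < n)%N ->
    nth 0 (unzip1 cs) (n + e) - nth 0 (unzip1 cs) e = 1.
Proof.
move=> tl; rewrite (@acc_chain 0) // add0n; split=> -[sz H]; split=> // e en.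
  by have := H e en (leq0n _); rewrite !subn0.
by move=> _; rewrite !subn0; apply: H.
Qed.

End ErrorAutomaton.

(** * The code of the error automaton *)

Lemma In_cat (T : Type) (s1 s2 : seq T) y :
  List.In y (s1 ++ s2) <-> List.In y s1 \/ List.In y s2.
Proof. by elim: s1 => [|x s1 IH] /=; [tauto | rewrite IH; tauto]. Qed.

Lemma In_flatten (T : Type) (ss : seq (seq T)) y :
  List.In y (flatten ss) <-> exists2 s, List.In s ss & List.In y s.
Proof.
elim: ss => [|s ss IH] /=; first by split=> // -[].
rewrite In_cat IH; split=> [[ys|[s' ? ?]]|[s' [->|?] ?]]; auto.
- by exists s; auto.
- by exists s'; auto.
- by right; exists s'.
Qed.

Section Transitions.
Variables (D : seq rule) (halt : control) (m : nat).
Let n := m.+2.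
Hypothesis D0 : 0 < size D.

Definition states :=
  [:: Guess; Start; Found; Tail; Gap; Gap'; First; Loading] ++
  map Chain (iota 0 n.*2.+1) ++ map Match (iota 0 (size D)) ++
  map Succ (iota 0 (size D)).

Definition valid s := match s with
  | Chain j => j <= n.*2 | Match a | Succ a => a < size D | _ => true end.

Lemma In_states s : List.In s states <-> valid s.
Proof.
rewrite /states !In_cat !In_map; split.
  case=> [|[[j jm ->]|[[j jm ->]|[j jm ->]]]]; try by move/In_mem: jm; rewrite mem_iota.
  by rewrite /=; intuition; subst.
case: s => [||||||||j|j|j] vs; try by left; rewrite /=; intuition.
- by right; left; exists j => //; apply/In_mem; rewrite mem_iota.
- by do 2!right; left; exists j => //; apply/In_mem; rewrite mem_iota.
- by do 3!right; exists j => //; apply/In_mem; rewrite mem_iota.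
Qed.

Definition base_transitions : seq (raw_transition n state) :=
  flatten [seq flatten [seq [seq (s, a, x) | x <- base_out D halt m s a]
                       | a <- iota 0 (size D).+1] | s <- states].

Definition all_transitions c := (Loading, 0, load_error m c) :: base_transitions.

Lemma In_base_transitions s a x : List.In (s, a, x) base_transitions <->
  [/\ valid s, a <= size D & List.In x (base_out D halt m s a)].
Proof.
rewrite In_flatten; split.
  move=> [_ /In_map[s' /In_states vs ->] /In_flatten[_ /In_map[a' /In_mem a'D ->]]].
  by move/In_map => [y yb [-> -> ->]]; split=> //; move: a'D; rewrite mem_iota.
move=> [vs aD xb]; eexists; first by apply/In_map; exists s; [apply/In_states|].
apply/In_flatten; eexists; last by apply/In_map; exists x; [exact: xb|].
by apply/In_map; exists a => //; apply/In_mem; rewrite mem_iota.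
Qed.

Lemma In_all_transitions c s a x : valid s ->
  List.In (s, a, x) (all_transitions c) <-> List.In x (out D halt m c s a).
Proof.
move=> vs; rewrite /= In_base_transitions /out; split.
  case=> [[<- <- <-] /=|[_ _ xb]]; first by left.
  by case: s vs xb => // _ xb; case: ifP => // _; right.
have base : List.In x (base_out D halt m s a) ->
    [/\ valid s, a <= size D & List.In x (base_out D halt m s a)].
  move=> xb; split=> //; move: xb; rewrite /base_out.
  by case: ltngtP.
case: s vs base => [||||||||j|j|j] vs base; try by right; apply: base.
case: (a =P 0) => [a0|_]; last by right; apply: base.
by case=> [<-|xb]; [left; rewrite a0 | right; apply: base].
Qed.

Lemma out_valid c s a x : valid s -> List.In x (out D halt m c s a) -> valid x.2.
Proof.
have chain j : List.In x (chain_out m j) -> valid x.2.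
  rewrite /chain_out; case: ltnP => [jn|_] /=.
    by case=> // <- /=; rewrite -addnn; lia.
  by case: ltnP => //= jn [] // <-.
have base : valid s -> List.In x (base_out D halt m s a) -> valid x.2.
  rewrite /base_out; case: ltngtP => // [aD|_].
    by case: s => [||||||||j|j|j] /= vs H; intuition; subst.
  by case: s => [||||||||j|j|j] //= vs; try exact: chain; case=> // <-.
move=> vs; rewrite /out; case: s vs base => [||||||||j|j|j] vs base;
  try exact: base.
by case: ifP => _; [case=> [<-|]; [|exact: base] | exact: base].
Qed.

(** Used as constant of [load_error] and as number of states and letters. This is not circular,
    since [base_transitions] does not depend on it. *)
Definition quine := CodeSeq.code (map (@raw_code n state num) base_transitions).

Lemma raw_code_gt (e : raw_transition n state) :
  [/\ num e.1.1 < raw_code num e, e.1.2 < raw_code num e & num e.2.2 < raw_code num e].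
Proof.
have := CodeSeq.ltn_code [:: num e.1.1; e.1.2; guard_code e.2.1.1;
  set_code e.2.1.2; num e.2.2].
by move=> /= /and5P[? ? _ _ /andP[]].
Qed.

(** The code of a list exceeds its entries, so [quine] bounds all states and letters that occur. *)
Lemma base_lt_quine e : List.In e base_transitions ->
  [/\ num e.1.1 < quine, e.1.2 < quine & num e.2.2 < quine].
Proof.
move=> eb; have : raw_code num e < quine.
  by apply: (allP (CodeSeq.ltn_code _)); apply/In_mem/In_map; exists e.
by have [? ? ?] := raw_code_gt e; move=> ?; split; lia.
Qed.

Lemma letter_lt_quine : size D < quine.
Proof.
have [|_ H _] := @base_lt_quine (Tail, size D, (GTrue n, finset.set0, Tail));
  last exact: H.
by apply/In_base_transitions; split=> //; rewrite /base_out ltnn eqxx; left.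
Qed.

(** Each family of states occurs in some base transition; the states numbered up to 7 lie below the
    last [Chain] state. *)
Lemma valid_lt_quine s : valid s -> num s < quine.
Proof.
have last_chain : num (Chain n.*2) < quine.
  have [|_ _ H] := @base_lt_quine (Chain n.*2.-1, size D,
    (GAtom (inord (n.*2.-1 - n)) OpEq 1, finset.set0, Chain n.*2)); last exact: H.
  apply/In_base_transitions; split; [exact: leq_pred | exact: leqnn | ].
  rewrite /base_out ltnn eqxx /tail_out /chain_out ifF; last by rewrite -addnn; lia.
  by rewrite ifT; [left | exact: leqnn].
case: s => [||||||||j|j|j] /= vs; try by move: last_chain => /=; lia.
- have [|H _ _] := @base_lt_quine (Match j, 0,
    (GAtom (clk0 m) OpLt 1, finset.set0, Match j)); last exact: H.
  by apply/In_base_transitions; split=> //; rewrite /base_out D0; left.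
- have [|H _ _] := @base_lt_quine (Succ j, 0,
    (when (tgt (rl D j) != src (rl D 0)) (GTrue n), finset.set0, Found)); last exact: H.
  by apply/In_base_transitions; split=> //; rewrite /base_out D0; left.
Qed.

Lemma all_bounded c e : List.In e (all_transitions c) ->
  raw_bounded num quine.-1 quine.-1 e.
Proof.
rewrite /raw_bounded; case=> [<-|/base_lt_quine[h1 h2 h3]]; last first.
  by split; rewrite -ltnS (ltn_predK h1).
have h : 7 < quine by apply: (@valid_lt_quine Loading).
by split; rewrite -ltnS (ltn_predK h) //; apply: leq_trans h.
Qed.

End Transitions.

(** * A recursive program for the code of the automaton *)

Fixpoint mconst c := if c is c'.+1 then MComp MSucc [:: mconst c'] else MZero.

Lemma computes_const c xs : computes (mconst c) xs c.
Proof.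
elim: c => [|c IH] /=; first by constructor.
by apply: (@computes_comp _ _ _ [:: c]); repeat constructor.
Qed.

Definition madd := MPrimRec (MProj 0) (MComp MSucc [:: MProj 1]).
Definition mdouble := MComp madd [:: MProj 0; MProj 0].
(** The code of [x :: s] from [x] and the code [y] of [s]: doubling [2 * y + 1] as many times as [x]
    says. *)
Definition mcons := MPrimRec (MComp MSucc [:: mdouble]) (MComp mdouble [:: MProj 1]).

Lemma computes_nth i xs x : i < size xs -> nth 0 xs i = x -> computes (MProj i) xs x.
Proof. by move=> ? <-; constructor. Qed.

Lemma computes_add x y : computes madd [:: x; y] (x + y).
Proof.
elim: x => [|x IH]; first by constructor; apply: computes_nth.
apply: computes_primrecS IH _; apply: (@computes_comp _ _ _ [:: x + y]).
  by repeat constructor; apply: computes_nth.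
exact: computes_succ.
Qed.

Lemma computes_double x xs : computes mdouble (x :: xs) x.*2.
Proof.
rewrite -addnn; apply: (@computes_comp _ _ _ [:: x; x]) (computes_add _ _).
by repeat constructor; apply: computes_nth.
Qed.

Lemma computes_mcons x y : computes mcons [:: x; y] (2 ^ x * y.*2.+1).
Proof.
elim: x => [|x IH].
  rewrite mul1n; constructor; apply: (@computes_comp _ _ _ [:: y.*2]).
    by repeat constructor; apply: computes_double.
  exact: computes_succ.
apply: computes_primrecS IH _; rewrite expnS -mulnA mul2n.
apply: (@computes_comp _ _ _ [:: 2 ^ x * y.*2.+1]); last exact: computes_double.
by repeat constructor; apply: computes_nth.
Qed.

Definition mcode (l : seq murec) := foldr (fun a b => MComp mcons [:: a; b]) MZero l.

Lemma computes_mcode l xs ys : computes_all l xs ys ->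
  computes (mcode l) xs (CodeSeq.code ys).
Proof.
elim: l ys => [|a l IH] ys H; inversion H; subst => /=; first by constructor.
apply: computes_comp (computes_mcons _ _); do ![constructor] => //.
exact: IH.
Qed.

(* Computes the code of the automaton from [quine], the code of the list of
   its transitions other than [load_error]. *)
Definition mquine m :=
  let x := MProj 0 in
  mcode [:: x; x; mconst (CodeSeq.code [:: 0; 1]); mconst (CodeSeq.code (finals m));
    MComp mcons [:: mcode [:: mconst 7; mconst 0;
        mcode [:: mconst 2; mcode [:: mconst 1; mconst (val (clk0 m)); mconst 2; x]];
        mconst (set_code (finset.set0 : {set 'I_m.+2})); mconst 2]; x]].

Definition error_automaton D halt m :
    timed_automaton (quine D halt m).-1.+1 m.+2 :=
  raw_automaton num (quine D halt m).-1 (quine D halt m).-1 [:: 0; 1] (finals m)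
    (all_transitions D halt m (quine D halt m)).

(** The input enters four times: as number of letters, as number of states, as constant of the
    guard, and as the code to which that of [load_error] is prepended. *)
Lemma computes_mquine D halt m : 0 < size D ->
  computes (mquine m) [:: quine D halt m]
    (automaton_code (existT _ _ (error_automaton D halt m))).
Proof.
move=> D0; set u := quine D halt m.
have u0 : u.-1.+1 = u by have := letter_lt_quine halt m D0; rewrite -/u; lia.
have u_gt3 : 3 < u by apply: (@valid_lt_quine D halt m D0 Tail).
have u_gt : num (Chain m.+2.*2) < u.
  by apply: (@valid_lt_quine D halt m D0); rewrite /valid leqnn.
set A := error_automaton D halt m.
have E1 : set_code (initial A) = CodeSeq.code [:: 0; 1].
  apply: (@set_code_ini u.-1 [:: 0; 1] isT); clearbody u; clear A.
  by rewrite /all; lia.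
have E2 : set_code (final A) = CodeSeq.code (finals m).
  apply: (@set_code_ini u.-1 (finals m) isT); clearbody u; clear A E1.
  by rewrite /finals /all; lia.
have E3 : [seq transition_code e | e <- transitions A] =
    [seq raw_code num e | e <- all_transitions D halt m u].
  rewrite -[transitions A]/(map (@of_raw _ _ num u.-1 u.-1)
    (all_transitions D halt m u)).
  rewrite -map_comp; have := @all_bounded D halt m D0 u; rewrite -/u.
  elim: (all_transitions D halt m u) => //= e l IH H.
  rewrite transition_code_of_raw; last by apply: H; left.
  by rewrite IH // => e' el; apply: H; right.
have -> : automaton_code (existT _ _ A) = CodeSeq.code [:: u; u;
    CodeSeq.code [:: 0; 1]; CodeSeq.code (finals m);
    CodeSeq.code [seq raw_code num e | e <- all_transitions D halt m u]].
  rewrite /automaton_code E1 E2 E3 -[nb_states A]/(u.-1.+1).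
  by rewrite [(quine D halt m).-1.+1]u0.
have x0 : computes (MProj 0) [:: u] u by apply: computes_nth.
have nil : computes_all [::] [:: u] [::] by constructor.
have cst c l ys : computes_all l [:: u] ys ->
  computes_all (mconst c :: l) [:: u] (c :: ys).
  by apply: computes_cons; apply: computes_const.
have var l ys : computes_all l [:: u] ys ->
  computes_all (MProj 0 :: l) [:: u] (u :: ys) by apply: computes_cons.
have g : computes (mcode [:: mconst 2; mcode [:: mconst 1; mconst (val (clk0 m));
    mconst 2; MProj 0]]) [:: u] (guard_code (load_error m u).1.1).
  apply: computes_mcode; apply: (cst 2); apply: computes_cons (nil).
  by apply: computes_mcode; do 3!apply: (cst); apply: (var).
have e : computes (mcode [:: mconst 7; mconst 0;
    mcode [:: mconst 2; mcode [:: mconst 1; mconst (val (clk0 m)); mconst 2; MProj 0]];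
    mconst (set_code (finset.set0 : {set 'I_m.+2})); mconst 2]) [:: u]
    (raw_code num (Loading, 0, load_error m u)).
  apply: computes_mcode; do 2!apply: (cst); apply: computes_cons (g) _.
  by do 2!apply: (cst).
apply: computes_mcode; do 2!apply: (var); do 2!apply: (cst).
apply: computes_cons (nil).
apply: (@computes_comp _ _ _ [:: raw_code num (Loading, 0, load_error m u); u]).
  by apply: computes_cons (e) _; apply: (var).
exact: (computes_mcons (raw_code num (Loading, 0, load_error m u)) u).
Qed.

(** * Reduction *)

Section Reduction.
Local Open Scope ring_scope.
Variables (R : realType) (D : seq rule) (halt : control) (m : nat).
Hypothesis D0 : (0 < size D)%N.
Let u := quine D halt m.
Let A := error_automaton D halt m.

Let u_pred : u.-1.+1 = u.
Proof. by apply: ltn_predK (letter_lt_quine halt m D0). Qed.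

Let D_le : (size D <= u.-1)%N.
Proof. by rewrite -ltnS u_pred; apply: letter_lt_quine. Qed.

Lemma dates_bounded k T (w : timed_word R k.+1) :
  all (fun p : event R => p.2 <= k)%N (dates T w).
Proof.
elim: w T => //= [[t a] w IH] T; apply/andP; split; last exact: IH.
exact: (leq_ord a).
Qed.

Lemma error_automatonP (w : timed_word R u.-1.+1) : language R A w <->
  acc num (out D halt m u) (finals m) Guess (fun=> 0) (dates 0 w) \/
  acc num (out D halt m u) (finals m) Start (fun=> 0) (dates 0 w).
Proof.
have H s : valid D m s -> aacc (A := A) (inord (num s)) (fun=> 0) (dates 0 w) <->
    acc num (out D halt m u) (finals m) s (fun=> 0) (dates 0 w).
  move=> vs; apply: (@raw_acc R _ _ num _ _ _ _ _ _ (valid D m)) => //.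
  - exact: num_inj.
  - by move=> s' vs'; rewrite -ltnS u_pred; apply: valid_lt_quine.
  - exact: all_bounded.
  - by move=> s' a x; apply: In_all_transitions.
  - by move=> s' a x; apply: out_valid.
  - exact: dates_bounded.
have u2 : (1 < u.-1.+1)%N by rewrite u_pred; apply: (@valid_lt_quine _ _ _ D0 Start).
rewrite languageP; split.
  case=> s; rewrite /A inE => s01 Hs.
  have [s0|s1] : s = inord (num Guess) \/ s = inord (num Start).
    move: s01; rewrite !inE => /orP[]/eqP sE; [left|right];
    by apply: val_inj; rewrite /= inordK //; apply: ltnW.
  - by left; apply/H => //; rewrite -s0.
  - by right; apply/H => //; rewrite -s1.
case=> /H => /(_ isT) Hs; eexists; try exact: Hs.
  by rewrite inE /= inordK // ltnW.
by rewrite inE /= inordK.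
Qed.

(** If all words of rules are bad, the language consists of rule letters followed by tail letters,
    without any timing condition. *)
Lemma universal_reducible :
  (forall v : seq (event R), incr 0 v -> is_word D v -> bad D halt u v) ->
  exists B : timed_automaton u.-1.+1 m.+1, language R B = language R A.
Proof.
move=> all_bad.
(* State [true] reads the rule letters and state [false] the tail letters; guards are trivial. *)
pose tt : arrow m.+1 bool := (GTrue m.+1, finset.set0, true).
pose ff : arrow m.+1 bool := (GTrue m.+1, finset.set0, false).
pose l : seq (raw_transition m.+1 bool) :=
  [:: (false, size D, ff), (true, size D, ff) & [seq (true, a, tt) | a <- iota 0 (size D)]].
pose nb (b : bool) := if b then 0%N else 1%N.
pose ou (b : bool) a := if a == size D then [:: ff] else
  if b && (a < size D)%N then [:: tt] else [::].
have l_b e : List.In e l -> raw_bounded nb u.-1 u.-1 e.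
  have u1 : (0 < u.-1)%N by apply: leq_trans D_le.
  case=> [<-|[<-|/In_map[a /In_mem]]]; first by split.
    by split.
  by rewrite mem_iota => /= aD ->; split=> //=; apply: leq_trans D_le; apply: ltnW.
have lE s a x : True -> List.In (s, a, x) l <-> List.In x (ou s a).
  move=> _; rewrite /ou /=; split.
    case=> [[<- <- <-]|[[<- <- <-]|/In_map[a' /In_mem]]]; try by rewrite eqxx; left.
    rewrite mem_iota => /= a'D [-> -> ->]; rewrite a'D.
    by rewrite ifF; [left | apply/negbTE; rewrite neq_ltn a'D].
  case: eqP => [->|_] /=; first by case: s; case=> // <-; auto.
  case: ifP => [/andP[-> aD]|_] //= [] // <-; do 2!right.
  by apply/In_map; exists a => //; apply/In_mem; rewrite mem_iota.
pose B := raw_automaton nb u.-1 u.-1 [:: 0%N] [:: 0%N; 1%N] l.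
have accF rho cs : is_tail D cs -> acc (R := R) nb ou [:: 0%N; 1%N] false rho cs.
  elim: cs rho => [//|[t a] cs IH] rho /andP[/eqP/= -> tl].
  by rewrite /acc -/acc /ou eqxx; left; split=> //; apply: IH.
have accT rho v cs : is_word D v -> is_tail D cs ->
    acc (R := R) nb ou [:: 0%N; 1%N] true rho (v ++ cs).
  elim: v rho => [|[t a] v IH] rho.
    case: cs => [//|[t a] cs] _ /andP[/eqP/= -> tl].
    by rewrite /acc -/acc /ou eqxx; left; split=> //; apply: accF.
  move=> /andP[/= aD vD] tl; rewrite /acc -/acc /ou ifF ?aD; last by lia.
  by left; split=> //; apply: IH.
have shape s rho w : acc (R := R) nb ou [:: 0%N; 1%N] s rho w -> exists v cs,
    [/\ w = v ++ cs, is_word D v, is_tail D cs & s || (v == [::])].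
  elim: w s rho => [|[t a] w IH] s rho.
    by move=> _; exists [::], [::]; split=> //; rewrite orbT.
  move/foldr_or => [x xo [_ /IH[v [cs [-> vD tl sh]]]]]; move: xo; rewrite /ou.
  case: eqP => [->|_].
    case=> // xE; rewrite -xE /= in sh; exists [::], ((t, size D) :: cs).
    by rewrite (eqP sh) /is_tail /= eqxx; split=> //; rewrite orbT.
  case: ifP => [/andP[-> aD] _|_ //]; exists ((t, a) :: v), cs.
  by rewrite /is_word /= aD.
have BP (w : timed_word R u.-1.+1) : language R B w <->
    acc nb ou [:: 0%N; 1%N] true (fun=> 0) (dates 0 w).
  have H : aacc (A := B) (inord (nb true)) (fun=> 0) (dates 0 w) <->
      acc nb ou [:: 0%N; 1%N] true (fun=> 0) (dates 0 w).
    apply: (@raw_acc R _ _ nb _ _ _ _ _ _ (fun=> True)) => //; last exact: dates_bounded.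
      by case=> -[].
    by case=> //= _; apply: leq_trans D_le.
  rewrite -H languageP; split=> [[s]|Hs].
    rewrite inE inE => /eqP s0; suff -> : s = inord (nb true) by [].
    by apply: val_inj; rewrite /= inordK.
  by exists (inord (nb true)) => //; rewrite inE /= inordK.
exists B; apply/seteqP; split=> w /=.
  move/BP/shape => [v [cs [E vD tl _]]]; apply/error_automatonP; rewrite E.
  have inc : incr 0 v by have := incr_dates 0 w; rewrite E incr_cat => /andP[].
  by apply/acc_bad => //; left; apply: all_bad.
move/error_automatonP => H; apply/BP.
suff [v [cs [-> vD tl]]] : exists v cs, [/\ dates 0 w = v ++ cs, is_word D v & is_tail D cs].
  exact: accT.
by case: H => /(acc_shape D0)[v [cs [E vD tl _]]]; exists v, cs.
Qed.

(** After a good [v] the tail must satisfy the timing condition of the chain, which [clock_bound]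
    rules out for [B]. *)
Lemma good_irreducible (v : seq (event R)) : incr 0 v -> is_word D v ->
  ~ bad D halt u v ->
  ~ exists B : timed_automaton u.-1.+1 m.+1, language R B = language R A.
Proof.
move=> inc vD nb [B BA].
apply: (@clock_bound R u.-1.+1 m.+2 B isT (size D) v inc) => cs inc_cs tl.
have [|w Ew] := @dates_onto R u.-1.+1 0 (v ++ cs) inc_cs.
  rewrite all_cat; apply/andP; split; apply/allP => p.
    by move/(allP vD) => pD; rewrite ltnS; apply: leq_trans D_le; apply: ltnW.
  by move/(allP tl)/eqP => ->; rewrite ltnS.
rewrite -Ew -languageP BA error_automatonP Ew.
have -> := @acc_bad D halt m R u D0 v cs inc vD tl.
by rewrite acc_tail //; split=> [[]//|]; right.
Qed.

End Reduction.

Theorem theorem2 (R : realType) (n : nat) (hn : 2 <= n) :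
  ~ algorithmically_decidable (@automaton_code n)
      (fun A : {k : nat & timed_automaton k n} =>
         exists B : timed_automaton (tag A) n.-1,
           language R B = language R (tagged A)).
Proof.
case: n hn => [|[|m]] // _ [f Hf].
(* [g] depends on [f] and [m] only; the machine, and then [u], are built from it. *)
pose g := MComp f [:: mquine m]; pose p := decision_prog g.
pose D := machine p; pose halt := halt_state p; pose u := quine D halt m.
have D0 : 0 < size D by [].
have u0 : 0 < u by apply: leq_ltn_trans (letter_lt_quine halt m D0).
have cg y : computes f [:: automaton_code (existT _ _ (error_automaton D halt m))] y ->
    computes g [:: u] y.
  move=> cf; apply: computes_comp (cf); apply: computes_cons (computes_nil _).
  exact: computes_mquine.
have [Hyes Hno] := Hf (existT _ _ (error_automaton D halt m)).
have [red|irr] := pselect (exists B : timed_automaton u.-1.+1 m.+1,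
    language R B = language R (error_automaton D halt m)).
  (* The answer is 1, so the machine halts from the queue that [load_end] leaves after loading [u];
     a good word exists and forbids [n - 1] clocks. *)
  have [w Hw] : exists w, qreach D ((1, 0), nseq u 1 ++ [:: 0]) (halt, w).
    apply: decision_halts (cg _ (Hyes red)) _; apply: repr_input.
    - by rewrite count_cat count_nseq mul0n.
    - by rewrite count_cat count_nseq mul1n addn0.
    - by rewrite all_cat all_nseq orbT.
  have [v [inc vD nb]] := good_of_halting R u0 Hw.
  exact: (good_irreducible D0 inc vD nb) red.
(* The answer is 0, so the machine loops; a good word would code a halting run on input [u]. *)
apply: (irr); apply: universal_reducible => // v inc vD.
apply: contrapT => nb; have [w [w' [c0 c1 w2 H]]] := halting_of_good inc vD nb.
exact: decision_loops (cg _ (Hno irr)) (repr_input _ c0 c1 w2) H.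
Qed.
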